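(* For every odd integer $\ell\ge 3$, the decision problem $\mathrm{PCSP}(C_\ell,K_4)$ is NP-hard.
   Context: Graphs are finite and undirected, viewed as symmetric binary relations (loops allowed); a graph homomorphism preserves edges, and $I\to G$ means a homomorphism exists. $C_\ell$ is the cycle of length $\ell$ and $K_4$ the complete loopless graph on $4$ vertices. The promise problem $\mathrm{PCSP}(C_\ell,K_4)$ is: given an input graph $I$, output YES if $I\to C_\ell$ and NO if $I\not\to K_4$ (inputs satisfying neither may be answered arbitrarily). *)

(* Defs.v *)
From mathcomp Require Import all_boot.

Set Implicit Arguments.
Unset Strict Implicit.
Unset Printing Implicit Defensive.

Inductive move := MoveL | MoveN | MoveR.

(* [Tape l r] is a two-way infinite tape: [r] lists the cells from the scanned
   one rightwards, [l] the cells left of the head, nearest first; cells beyond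
   either list are blank. The blank symbol is [None]. *)
Record tape (S : Type) :=
  Tape { tape_left : seq (option S); tape_right : seq (option S) }.

Definition tape_read S (t : tape S) : option S := head None (tape_right t).

Definition tape_write S (a : option S) (t : tape S) : tape S :=
  Tape (tape_left t) (a :: behead (tape_right t)).

Definition tape_move S (m : move) (t : tape S) : tape S :=
  match m with
  | MoveL => Tape (behead (tape_left t))
                  (head None (tape_left t) :: tape_right t)
  | MoveN => t
  | MoveR => Tape (tape_read t :: tape_left t) (behead (tape_right t))
  end.

Definition blank_tape S : tape S := Tape [::] [::].

Definition input_tape S (w : seq S) : tape S := Tape [::] (map Some w).

Fixpoint nonblank_prefix S (s : seq (option S)) : seq S :=
  if s is Some a :: s' then a :: nonblank_prefix s' else [::].

(* The word on a tape starts at the head and stops before the first blank. *)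
Definition tape_word S (t : tape S) : seq S := nonblank_prefix (tape_right t).

(* Machines with input alphabet [A] and output alphabet [B], having
   [tm_tapes.+1] tapes; the first one holds the input and the last one the
   output. The tape alphabet is [option tm_sym]. *)
Record tm (A B : finType) := TM {
  tm_tapes : nat;
  tm_sym : finType;
  tm_in : A -> tm_sym;
  tm_in_inj : injective tm_in;
  tm_out : B -> tm_sym;
  tm_out_inj : injective tm_out;
  tm_state : finType;
  tm_start : tm_state;
  tm_halt : pred tm_state;
  tm_trans : tm_state -> {ffun 'I_tm_tapes.+1 -> option tm_sym} ->
             tm_state * {ffun 'I_tm_tapes.+1 -> option tm_sym * move}
}.

Section Execution.
Variables (A B : finType) (M : tm A B).

Record config := Config {
  cfg_state : tm_state M;
  cfg_tapes : {ffun 'I_(tm_tapes M).+1 -> tape (tm_sym M)}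
}.

Definition tm_init (x : seq A) : config :=
  Config (tm_start M)
    [ffun i => if i == ord0 then input_tape (map (@tm_in _ _ M) x)
               else blank_tape (tm_sym M)].

(* Halting configurations are fixed points. *)
Definition tm_step (c : config) : config :=
  if tm_halt (cfg_state c) then c else
  let: (q, act) :=
    tm_trans (cfg_state c) [ffun i => tape_read (cfg_tapes c i)] in
  Config q [ffun i => tape_move (act i).2
                        (tape_write (act i).1 (cfg_tapes c i))].

Definition tm_outputs_within (t : nat) (x : seq A) (y : seq B) : Prop :=
  let c := iter t tm_step (tm_init x) in
  tm_halt (cfg_state c) /\
  tape_word (cfg_tapes c ord_max) = map (@tm_out _ _ M) y.

End Execution.

(* Every polynomial with natural coefficients is dominated by one of these. *)
Definition poly_bound (c d n : nat) : nat := c * n ^ d + c.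

Definition polytime (A B : finType) (f : seq A -> seq B) : Prop :=
  exists (M : tm A B) (c d : nat),
    forall x, tm_outputs_within M (poly_bound c d (size x)) x (f x).

Definition polytime_decidable (A : finType) (V : seq A -> bool) : Prop :=
  polytime (fun w => [:: V w]).

Definition language := seq bool -> Prop.

(* [None] separates the input from the certificate. *)
Definition with_certificate (x y : seq bool) : seq (option bool) :=
  map Some x ++ None :: map Some y.

Definition NP (L : language) : Prop :=
  exists (V : seq (option bool) -> bool) (c d : nat),
    polytime_decidable V /\
    forall x, L x <-> exists y : seq bool,
      size y <= poly_bound c d (size x) /\ V (with_certificate x y).

Record promise_problem := PromiseProblem {
  yes_instance : language;
  no_instance : language
}.

Definition karp_reduces (L : language) (P : promise_problem) : Prop :=
  exists f : seq bool -> seq bool,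
    polytime f /\
    forall x, (L x -> yes_instance P (f x)) /\ (~ L x -> no_instance P (f x)).

Definition NP_hard (P : promise_problem) : Prop :=
  forall L : language, NP L -> karp_reduces L P.

Record graph := Graph {
  vertex : finType;
  edge : rel vertex;
  edge_sym : symmetric edge
}.

Definition has_hom (G H : graph) : Prop :=
  exists f : vertex G -> vertex H,
    forall x y, edge x y -> edge (f x) (f y).

Definition cycle_rel (l : nat) : rel 'I_l :=
  fun i j => (j == ordS i) || (i == ordS j).

Lemma cycle_rel_sym l : symmetric (@cycle_rel l).
Proof. by move=> i j; rewrite /cycle_rel orbC. Qed.

Definition cycle_graph (l : nat) : graph := Graph (@cycle_rel_sym l).

Definition complete_rel (n : nat) : rel 'I_n := fun i j => i != j.

Lemma complete_rel_sym n : symmetric (@complete_rel n).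
Proof. by move=> i j; rewrite /complete_rel eq_sym. Qed.

Definition complete_graph (n : nat) : graph := Graph (@complete_rel_sym n).

(* The number of vertices in unary, then the adjacency matrix row by row. *)
Definition encode_graph (G : graph) : seq bool :=
  nseq #|vertex G| true ++ false ::
  [seq edge x y | x <- enum (vertex G), y <- enum (vertex G)].

Definition PCSP (G H : graph) : promise_problem := {|
  yes_instance w := exists I : graph, w = encode_graph I /\ has_hom I G;
  no_instance w := exists I : graph, w = encode_graph I /\ ~ has_hom I H
|}.

(* Main.v *)
(** The proof avoids both topology and the PCP theorem.

    A homomorphism [f] from a power of the odd cycle C_l to K_4 lifts to the lattice
    of integer points. Counting rainbow faces on the strip between two parallel
    diagonals gives a mod 2 cochain, closed because opposite corners of every lattice
    cube have a common neighbour and hence miss a colour. Integrating it around the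
    torus in direction [i] gives a bit [alpha_i], an elementary form of the equivariant
    homotopy class of [f]. These bits add up under taking minors and their sum is 1, so
    that the set [sel f] of coordinates with [alpha_i = 1] is nonempty, and it is
    compatible with minors. Its size is bounded in terms of [l] alone: a primitive of
    the cochain is antiperiodic in these coordinates, but on each unit cube it depends
    only on the colours along one diagonal; a spectral gap in each such direction
    forbids this in high dimension.

    For a constraint satisfaction problem, take a copy of a power of C_l for each
    bounded set [U] of variables, with one coordinate per satisfying assignment of [U].
    A 4-colouring selects boundedly many assignments for each [U], and the selection for
    a subset is contained in the restriction of that for a superset. If [U] is such that
    the size of the selection does not increase when a few variables are added, then a
    selected assignment of [U] extends uniquely, and these extensions form a global
    solution.

    The constraint satisfaction problem is the tableau of the verifier, with tape cells
    indexed relative to the heads. Its cells are numbered by digits in base [n], such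
    that adjacency of two vertices is decided by a finite automaton reading the input
    and the digits in parallel; a multi-tape machine runs this automaton for all pairs
    of vertices, like an odometer. *)

Require Import Defs.
From mathcomp Require Import all_boot.
From mathcomp Require Import all_order all_algebra zify ring.
From Stdlib Require Import ClassicalEpsilon.

Set Implicit Arguments.
Unset Strict Implicit.
Unset Printing Implicit Defensive.

(** * Rainbow faces of four-coloured cubes *)

(* For a face [p q r s] of a four-coloured quadrangulation with marked diagonal
   [p], [r]: the face is rainbow and colour [3] lies on the marked diagonal.
   Summed over the faces around a closed surface, this is the degree mod 2 of the
   induced map to the 2-sphere, counted over one triangle of the box complex. *)
Definition corner (p q r s : nat) : bool :=
  [&& p != r, q != s & (p == 3) (+) (r == 3)].

(* A solution of the linear system over F_2 expressed by [cut_square]; it is not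
   symmetric in the colours. *)
Definition cut (p q : nat) : bool := (p, q) \in [:: (0, 2); (2, 1); (1, 0)].

Definition missed (s : seq nat) := exists2 v, v < 4 & v \notin s.

Definition quad_proper (p q r s : nat) := [&& p != q, q != r, r != s & s != p].

(** The coboundary of [corner] on a cube: [a], [c], [b'], [d'] are one class of its bipartition and
    carry the marked diagonals of all six faces. *)
Definition cube_identity (a b c d a' b' c' d' : nat) : bool :=
  corner a b b' a' (+) corner c b b' c' (+) corner c d d' c' (+) corner a d d' a'
  == corner a b c d (+) corner b' c' d' a'.

Definition below4_all (P : nat -> bool) := all P (iota 0 4).

Lemma below4_allP (P : nat -> bool) : below4_all P -> forall a, a < 4 -> P a.
Proof. by move=> /allP h a ha; apply: h; rewrite mem_iota. Qed.

Lemma cube_identityP a b c d a' b' c' d' :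
  all (fun v => v < 4) [:: a; b; c; d; a'; b'; c'; d'] ->
  quad_proper a b c d -> quad_proper a' b' c' d' ->
  [&& a != a', b != b', c != c' & d != d'] ->
  missed [:: a; c; b'; d'] -> missed [:: b; d; a'; c'] ->
  cube_identity a b c d a' b' c' d'.
Proof.
pose miss (s : seq nat) := has (fun v => v \notin s) (iota 0 4).
have missP s : missed s -> miss s.
  by case=> v v4 vs; apply/hasP; exists v; rewrite ?mem_iota.
(* A finite check. Each properness condition stands right after the last colour it mentions, which
   prunes the enumeration. *)
have : below4_all (fun a => below4_all (fun b => (a != b) ==>
  below4_all (fun c => (b != c) ==> below4_all (fun d => ((c != d) && (d != a)) ==>
  below4_all (fun a' => (a != a') ==> below4_all (fun b' => ((b != b') && (a' != b')) ==>
  below4_all (fun c' => ((c != c') && (b' != c')) ==> below4_all (fun d' =>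
  [&& d != d', c' != d', d' != a', miss [:: a; c; b'; d'] & miss [:: b; d; a'; c']] ==>
  cube_identity a b c d a' b' c' d')))))))).
  by vm_compute.
move=> H /and5P[a4 b4 c4 d4 /and5P[a'4 b'4 c'4 d'4 _]].
move=> /and4P[ab bc cd da] /and4P[ab' bc' cd' da'] /and4P[aa' bb' cc' dd'].
move=> /missP m1 /missP m2.
have /implyP/(_ ab) {}H := below4_allP (below4_allP H a4) b4.
have /implyP/(_ bc) {}H := below4_allP H c4.
have := below4_allP H d4; rewrite cd da /= => {}H.
have := below4_allP H a'4; rewrite aa' /= => {}H.
have := below4_allP H b'4; rewrite bb' ab' /= => {}H.
have := below4_allP H c'4; rewrite cc' bc' /= => {}H.
by have := below4_allP H d'4; rewrite dd' cd' da' m1 m2.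
Qed.

Lemma cut_square p q r s : all (fun v => v < 4) [:: p; q; r; s] ->
  quad_proper p q r s ->
  cut p q (+) cut r q (+) cut r s (+) cut p s =
  corner p q r s (+) corner q r s p.
Proof.
have H : below4_all (fun p => below4_all (fun q => below4_all (fun r =>
   below4_all (fun s => quad_proper p q r s ==>
  (cut p q (+) cut r q (+) cut r s (+) cut p s ==
  corner p q r s (+) corner q r s p))))) by vm_compute.
move=> /and5P[p4 q4 r4 s4 _] pr.
have := below4_allP (below4_allP (below4_allP (below4_allP H p4) q4) r4) s4.
by rewrite pr => /eqP.
Qed.

Lemma cut_swap p q : p < 4 -> q < 4 -> p != q ->
  cut p q (+) cut q p = (p != 3) && (q != 3).
Proof.
have H : below4_all (fun p => below4_all (fun q => (p != q) ==>
  (cut p q (+) cut q p == (p != 3) && (q != 3)))) by vm_compute.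
move=> p4 q4 pq; have := below4_allP (below4_allP H p4) q4.
by rewrite pq => /eqP.
Qed.

Lemma corner_rot2 p q r s : corner p q r s = corner r s p q.
Proof. by rewrite /corner eq_sym (eq_sym q) addbC. Qed.

(* The marked vertices are those of even type: the [c k] for [k] even and the
   [d k] for [k] odd. *)
Definition face (c d : nat -> nat) (k : nat) : bool :=
  if odd k then corner (d k) (c k) (c k.+1) (d k.+1)
  else corner (c k) (d k) (d k.+1) (c k.+1).

(* Since [l] is odd, an [l]-periodic walk changes type after one period; [cut]
   compensates for this at the seam. *)
Definition twist (l : nat) (c d : nat -> nat) : bool :=
  cut (c 0) (d 0) (+) \big[addb/false]_(k < l) face c d k.

Lemma eq_twist l c c' d d' : c =1 c' -> d =1 d' -> twist l c d = twist l c' d'.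
Proof.
move=> hc hd; rewrite /twist hc hd; congr addb; apply: eq_bigr => k _.
by rewrite /face !hc !hd.
Qed.

(** The face separating consecutive cubes of the column, with the vertices of even type marked as in
    [face]. *)
Definition slice (c d c' d' : nat -> nat) (k : nat) : bool :=
  if odd k then corner (d k) (c' k) (d' k) (c k)
  else corner (c k) (d k) (c' k) (d' k).

Lemma addb_telescope (s : nat -> bool) n :
  \big[addb/false]_(k < n) (s k (+) s k.+1) = s 0 (+) s n.
Proof.
elim: n => [|n IH]; first by rewrite big_ord0 addbb.
by rewrite big_ord_recr /= IH -addbA addKb.
Qed.

Section Square.
Variables (l : nat) (c d c' d' : nat -> nat).
Hypothesis odd_l : odd l.
Hypothesis c4 : forall k, all (fun v => v < 4) [:: c k; d k; c' k; d' k].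
Hypothesis per : [/\ c l = c 0, d l = d 0, c' l = c' 0 & d' l = d' 0].
Hypothesis proper : forall k, quad_proper (c k) (d k) (c' k) (d' k).
Hypothesis next : forall k,
  [&& c k != c k.+1, d k != d k.+1, c' k != c' k.+1 & d' k != d' k.+1].
Hypothesis miss1 : forall k, missed [:: c k; c' k; d k.+1; d' k.+1].
Hypothesis miss2 : forall k, missed [:: d k; d' k; c k.+1; c' k.+1].

Lemma face_cube k :
  face c d k (+) face c' d k (+) face c' d' k (+) face c d' k =
  slice c d c' d' k (+) slice c d c' d' k.+1.
Proof.
have /and5P[a1 a2 a3 a4 _] := c4 k; have /and5P[b1 b2 b3 b4 _] := c4 k.+1.
have /and4P[p1 p2 p3 p4] := proper k; have /and4P[q1 q2 q3 q4] := proper k.+1.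
have /and4P[n1 n2 n3 n4] := next k.
rewrite /face /slice /=; case: (odd k) => /=.
  (* For odd [k] the vertices [d k] and [d' k] have even type, so the cube is read starting from
     [d k]. *)
  have := @cube_identityP (d k) (c' k) (d' k) (c k)
            (d k.+1) (c' k.+1) (d' k.+1) (c k.+1).
  rewrite /= a1 a2 a3 a4 b1 b2 b3 b4 n1 n2 n3 n4 /quad_proper.
  rewrite p1 p2 p3 p4 q1 q2 q3 q4.
  have m1 : missed [:: d k; d' k; c' k.+1; c k.+1].
    have [v v4 vn] := miss2 k; exists v => //.
    by move: vn; rewrite !inE; do 4?[case: eqP => //=].
  have m2 : missed [:: c' k; c k; d k.+1; d' k.+1].
    have [v v4 vn] := miss1 k; exists v => //.
    by move: vn; rewrite !inE; do 4?[case: eqP => //=].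
  move=> /(_ isT isT isT isT m1 m2) /eqP.
  rewrite (corner_rot2 (c' k.+1)).
  by do 6![case: (corner _ _ _ _)].
have := @cube_identityP (c k) (d k) (c' k) (d' k)
            (c k.+1) (d k.+1) (c' k.+1) (d' k.+1).
rewrite /= a1 a2 a3 a4 b1 b2 b3 b4 n1 n2 n3 n4 /quad_proper.
rewrite p1 p2 p3 p4 q1 q2 q3 q4.
move=> /(_ isT isT isT isT (miss1 k) (miss2 k)) /eqP.
by do 6![case: (corner _ _ _ _)].
Qed.

(** Summing [face_cube] over a period leaves the slices at levels [0] and [l]. They are the same
    square, but since [l] is odd opposite diagonals are marked. Their sum is what [cut_square]
    assigns to the four seam terms. *)
Lemma twist_square :
  twist l c d (+) twist l c' d (+) twist l c' d' (+) twist l c d' = false.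
Proof.
rewrite /twist; set S1 := bigop.body _ _ _; set S2 := bigop.body _ _ _.
set S3 := bigop.body _ _ _; set S4 := bigop.body _ _ _.
have tele : S1 (+) S2 (+) S3 (+) S4 = slice c d c' d' 0 (+) slice c d c' d' l.
  rewrite /S1 /S2 /S3 /S4 -!big_split /=.
  by rewrite (eq_bigr _ (fun (k : 'I_l) _ => face_cube k)) addb_telescope.
have := cut_square (c4 0) (proper 0).
have : slice c d c' d' l = corner (d 0) (c' 0) (d' 0) (c 0).
  by rewrite /slice odd_l; case: per => -> -> -> ->.
move: tele; rewrite {1}/slice /= => tele e1 e2.
rewrite e1 in tele; clearbody S1 S2 S3 S4.
move: tele e2; move: S1 S2 S3 S4 (cut _ _) (cut _ _) (cut _ _) (cut _ _)
  (corner _ _ _ _) (corner _ _ _ _).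
by do 10![case].
Qed.
End Square.

(** * A closed cochain on the lattice *)

Section Lattice.
Variable D : finType.

Definition point := {ffun D -> nat}.

Definition padd (x y : point) : point := [ffun i => x i + y i].
Definition pconst (k : nat) : point := [ffun=> k].
Definition pind (S : {set D}) : point := [ffun i => (i \in S) : nat].
Definition pscale (k : nat) (x : point) : point := [ffun i => k * x i].

Definition padj (x y : point) : Prop :=
  forall i, x i = (y i).+1 \/ y i = (x i).+1.

Definition fold1 (k : nat) : nat := if k is k'.+1 then k' else 1.
Definition pfold (x : point) : point := [ffun i => fold1 (x i)].

Lemma padjC x y : padj x y -> padj y x.
Proof. by move=> h i; case: (h i); [right | left]. Qed.

Lemma padj_shift x y z : padj x y -> padj (padd x z) (padd y z).
Proof. by move=> h i; rewrite !ffunE; case: (h i) => ->; [left | right]. Qed.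

Lemma padj_succ x k : padj (padd x (pconst k)) (padd x (pconst k.+1)).
Proof. by move=> i; rewrite !ffunE addnS; right. Qed.

Lemma padj_fold x : padj x (pfold x).
Proof. by move=> i; rewrite !ffunE; case: (x i) => [|k]; [right | left]. Qed.

Lemma pfold_adj x y : padj x y -> padj (pfold x) (pfold y).
Proof.
move=> h i; rewrite !ffunE; case: (h i) => ->.
  by case: (y i) => [|k]; [right | left].
by case: (x i) => [|k]; [left | right].
Qed.

(* Opposite corners of a cube spanned by a closed walk of length four and the
   diagonal direction have a common neighbour, so that the box complex of the
   lattice has no essential sphere there. *)
Lemma cube_center1 x y x' y' k : padj x y -> padj x' y -> padj x' y' -> padj x y' ->
  exists v, [/\ padj (padd x (pconst k)) v, padj (padd x' (pconst k)) v,
    padj (padd y (pconst k.+1)) v & padj (padd y' (pconst k.+1)) v].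
Proof.
move=> h1 h2 h3 h4.
(* Having the neighbour [y] in common, [x] and [x'] agree or differ by 2 in each coordinate. The
   centre lies between them if they differ, and just above both if they agree. *)
exists [ffun i => if x i == (x' i).+2 then (x i + k).-1 else (x i + k).+1].
by split=> i; move: (h1 i) (h2 i) (h3 i) (h4 i); rewrite !ffunE; case: eqP; lia.
Qed.

Lemma cube_center2 x y x' y' k : padj x y -> padj x' y -> padj x' y' -> padj x y' ->
  exists v, [/\ padj (padd y (pconst k)) v, padj (padd y' (pconst k)) v,
    padj (padd x (pconst k.+1)) v & padj (padd x' (pconst k.+1)) v].
Proof.
move=> h1 h2 h3 h4.
exists [ffun i => if x' i == (x i).+2 then (x i + k).+2 else (x i + k)].
by split=> i; move: (h1 i) (h2 i) (h3 i) (h4 i); rewrite !ffunE; case: eqP; lia.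
Qed.

End Lattice.

Arguments pconst {D}.

Section Cochain.
Variables (D : finType) (W : Type) (l : nat).
Hypotheses (l_gt0 : 0 < l) (odd_l : odd l).

Definition torus := {ffun D -> 'I_l}.

Definition torus_adj (x y : torus) : Prop := forall i, cycle_rel (x i) (y i).

Definition modl (k : nat) : 'I_l := Ordinal (ltn_pmod k l_gt0).

Definition residue (x : point D) : torus := [ffun i => modl (x i)].

Lemma residue_adj x y : padj x y -> torus_adj (residue x) (residue y).
Proof.
have ordSE k : ordS (modl k) = modl k.+1.
  by apply: val_inj => /=; rewrite -addn1 modnDml addn1.
move=> h i; rewrite !ffunE /cycle_rel !ordSE.
by case: (h i) => ->; rewrite eqxx ?orbT.
Qed.

Lemma residue_periodic x y : residue (padd x (pscale l y)) = residue x.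
Proof.
by apply/ffunP=> i; rewrite !ffunE; apply: val_inj; rewrite /= addnC mulnC modnMDl.
Qed.

(* The labels [W] do not affect adjacency. Two labels allow comparing two
   polymorphisms that are adjacent in the exponential graph. *)
Variable f : W -> torus -> 'I_4.
Hypothesis f_hom : forall s s' x y, torus_adj x y -> f s x != f s' y.

Notation lpoint := (W * point D)%type.

Definition colour (p : lpoint) : nat := f p.1 (residue p.2).

Definition diag (p : lpoint) (k : nat) : nat := colour (p.1, padd p.2 (pconst k)).

Definition ladj (p q : lpoint) := padj p.2 q.2.

Lemma colour_lt p : colour p < 4. Proof. exact: ltn_ord. Qed.

Lemma colour_adj p q : ladj p q -> colour p != colour q.
Proof. by move=> h; apply: f_hom; apply: residue_adj. Qed.

Lemma diag_periodic p k : diag p (k + l) = diag p k.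
Proof.
rewrite /diag /colour /=.
have -> : padd p.2 (pconst (k + l)) =
    padd (padd p.2 (pconst k)) (pscale l (pconst 1)).
  by apply/ffunP=> i; rewrite !ffunE muln1 addnA.
by rewrite residue_periodic.
Qed.

Definition link (p q : lpoint) : bool := twist l (diag p) (diag q).

(** Closedness of the cochain: the colour of a common neighbour of four alternate corners of a cube
    is missed by these corners. *)
Lemma link_square p q p' q' : ladj p q -> ladj p' q -> ladj p' q' -> ladj p q' ->
  link p q (+) link p' q (+) link p' q' (+) link p q' = false.
Proof.
move=> h1 h2 h3 h4; apply: twist_square => //.
- by move=> k; rewrite /= !colour_lt.
- have per a : diag a l = diag a 0 by rewrite -(diag_periodic a 0) add0n.
  by split; apply: per.
- move=> k; apply/and4P; split; apply: colour_adj; apply: padj_shift => //;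
  exact: padjC.
- by move=> k; apply/and4P; split; apply: colour_adj; apply: padj_succ.
- move=> k; have [v [a1 a2 a3 a4]] := cube_center1 k h1 h2 h3 h4.
  exists (colour (p.1, v)); first exact: colour_lt.
  by rewrite !inE; apply/norP; split; last (apply/norP; split; last (apply/norP;
    split)); rewrite eq_sym; apply: colour_adj.
- move=> k; have [v [a1 a2 a3 a4]] := cube_center2 k h1 h2 h3 h4.
  exists (colour (p.1, v)); first exact: colour_lt.
  by rewrite !inE; apply/norP; split; last (apply/norP; split; last (apply/norP;
    split)); rewrite eq_sym; apply: colour_adj.
Qed.

(** [link] expects the point of even type first; [b] tells whether this is [p]. *)
Definition olink (b : bool) (p q : lpoint) := if b then link p q else link q p.

Lemma olink_square b p q p' q' : ladj p q -> ladj p' q -> ladj p' q' -> ladj p q' ->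
  olink b p q (+) olink (~~ b) q p' (+) olink b p' q' (+) olink (~~ b) q' p = false.
Proof.
case: b => h1 h2 h3 h4 /=; first exact: link_square.
have := @link_square q p q' p' (padjC h1) (padjC h4) (padjC h3) (padjC h2).
by move: (link q p) (link q' p) (link q' p') (link q p'); do 4![case].
Qed.

Variable s0 : W.

Definition lfold (p : lpoint) : lpoint := (s0, pfold p.2).

(* [pfold] contracts the lattice, one unit step at a time, so that closed cochains
   are exact. *)
Definition potential_upto (N : nat) (b : bool) (p : lpoint) : bool :=
  \big[addb/false]_(j < N) olink (b (+) odd j) (iter j lfold p) (iter j.+1 lfold p).

Lemma iter_lfold_adj j p q : ladj p q -> ladj (iter j lfold p) (iter j lfold q).
Proof.
by move=> h; elim: j => [|j IH] //=; rewrite /ladj /=; apply: pfold_adj.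
Qed.

(** A chain homotopy from the identity to [N]-fold folding: an edge, its folded image and the two
    folding steps form a square, to which [olink_square] applies. *)
Lemma potential_step N b p q : ladj p q ->
  olink b p q = potential_upto N b p (+) potential_upto N (~~ b) q (+)
    olink (b (+) odd N) (iter N lfold p) (iter N lfold q).
Proof.
move=> h; elim: N => [|N IH]; first by rewrite /potential_upto !big_ord0 /= addbF.
rewrite IH /potential_upto !big_ord_recr /=.
set pN := iter N lfold p; set qN := iter N lfold q.
have hN : ladj pN qN by apply: iter_lfold_adj.
have := @olink_square (b (+) odd N) pN qN (lfold qN) (lfold pN) hN
  (padjC (padj_fold _)) (padjC (pfold_adj hN)) (padj_fold _).
rewrite addbN addNb.
have sw c u v : olink (~~ c) u v = olink c v u by case: c.
rewrite !sw.
move: (bigop.body _ _ _) (bigop.body _ _ _) (olink _ _ _) (olink _ _ _)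
  (olink _ _ _) (olink _ _ _).
by do 6![case].
Qed.

Lemma iter_fold1 N k : k <= N -> iter N fold1 k = odd (N - k).
Proof.
elim: N => [|N IH]; first by rewrite leqn0 => /eqP ->.
rewrite leq_eqVlt => /predU1P[->|kN]; last first.
  by rewrite iterS IH // subSn //=; case: (odd _).
rewrite subnn /=; elim: N {k IH} => [|N IH] //.
by rewrite [iter N.+1 _ _]iterSr.
Qed.

Definition even_point (b : bool) (p : lpoint) := forall i, odd (p.2 i) = ~~ b.

Lemma iter_lfold N (p : lpoint) : iter N.+1 lfold p = (s0, [ffun i => iter N.+1 fold1 (p.2 i)]).
Proof.
elim: N => [|N IH]; first by congr pair; apply/ffunP=> i; rewrite !ffunE.
by rewrite iterS IH; congr pair; apply/ffunP=> i; rewrite !ffunE.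
Qed.

Lemma iter_lfold_const N b (p : lpoint) : 0 < N -> ~~ odd N -> (forall i, p.2 i <= N) ->
  even_point b p -> iter N lfold p = (s0, pconst (~~ b)).
Proof.
case: N => // N _ evN le_pN ep; rewrite iter_lfold; congr pair.
apply/ffunP=> i; rewrite !ffunE iter_fold1 // oddB // (negbTE evN) ep.
by case: (b).
Qed.

Lemma lfold_const (b : bool) : lfold (s0, pconst b) = (s0, pconst (~~ b)).
Proof. by congr pair; apply/ffunP=> i; rewrite !ffunE; case: b. Qed.

(** Once folding has reached the constant points 0 and 1, it alternates between them, and two
    consecutive terms are the same link and cancel. *)
Lemma potential_upto_add N b (p : lpoint) k : 0 < N -> ~~ odd N -> (forall i, p.2 i <= N) ->
  even_point b p -> potential_upto (N + k.*2) b p = potential_upto N b p.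
Proof.
move=> N0 evN le_pN ep; elim: k => [|k IH]; first by rewrite addn0.
rewrite doubleS !addnS -IH /potential_upto !big_ord_recr /= -!addbA.
have -> : iter (N + k.*2) lfold p = (s0, pconst (~~ b)).
  apply: iter_lfold_const => //; first by rewrite addn_gt0 N0.
    by rewrite oddD odd_double addbF.
  by move=> i; apply: leq_trans (le_pN i) (leq_addr _ _).
rewrite !lfold_const oddD odd_double (negbTE evN) !addbF addbT negbK.
by case: b {ep IH} => /=; rewrite addbb addbF.
Qed.

(** Positive, even and at least every coordinate, so that after this many folds a point has reached
    a constant point. *)
Definition pot_height (p : lpoint) := (\sum_i p.2 i).*2.+2.

Lemma pot_height_ge (p : lpoint) i : p.2 i <= pot_height p.
Proof.
rewrite /pot_height (bigD1 i) //= -addnn; do 2 apply: leqW.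
by rewrite -!addnA leq_addr.
Qed.

Definition potential (b : bool) (p : lpoint) := potential_upto (pot_height p) b p.

Lemma potentialE N b (p : lpoint) : 0 < N -> ~~ odd N -> (forall i, p.2 i <= N) ->
  even_point b p -> potential_upto N b p = potential b p.
Proof.
move=> N0 evN le_pN ep; rewrite /potential.
rewrite -(potential_upto_add (pot_height p)./2 N0) //.
rewrite -[in RHS](@potential_upto_add _ _ _ N./2) //; first last.
- exact: pot_height_ge.
- by rewrite /pot_height /= odd_double.
have evP : ~~ odd (pot_height p) by rewrite /= odd_double.
by rewrite (even_halfK evN) (even_halfK evP) addnC.
Qed.

(** After enough folding every edge becomes the edge between the constant points 0 and 1; this gives
    the last term, which cancels in differences. *)
Lemma potential_link b p q : ladj p q -> even_point b p -> even_point (~~ b) q ->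
  olink b p q = potential b p (+) potential (~~ b) q (+)
    link (s0, pconst 0) (s0, pconst 1).
Proof.
move=> h ep eq; pose N := pot_height p + pot_height q.
have evN : ~~ odd N by rewrite oddD /pot_height /= !odd_double.
have N0 : 0 < N by [].
have leN1 i : p.2 i <= N := leq_trans (pot_height_ge p i) (leq_addr _ _).
have leN2 i : q.2 i <= N := leq_trans (pot_height_ge q i) (leq_addl _ _).
rewrite (potential_step N b h) (iter_lfold_const N0 evN leN1 ep).
rewrite (iter_lfold_const N0 evN leN2 eq) (negbTE evN) addbF.
by rewrite !potentialE //; case: (b).
Qed.

Lemma potential_link2 p p' q : ladj p q -> ladj p' q ->
  even_point true p -> even_point true p' -> even_point false q ->
  link p q (+) link p' q = potential true p (+) potential true p'.
Proof.
move=> h h' ep ep' eq; have := potential_link h ep eq; have := potential_link h' ep' eq.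
rewrite /= => -> ->; move: (potential _ p) (potential _ p') (potential _ q) (link _ _).
by do 4![case].
Qed.

(** Multiples of [l] preserve residues; the factor 2 preserves parity as well. *)
Definition translate (p : lpoint) (z : point D) : lpoint :=
  (p.1, padd p.2 (pscale (2 * l) z)).

Lemma link_shift p q z : link (translate p z) (translate q z) = link p q.
Proof.
have E r : diag (translate r z) =1 diag r.
  move=> k; rewrite /diag /colour /=; congr (nat_of_ord (f _ _)).
  rewrite -[RHS](residue_periodic _ (pscale 2 z)); congr residue.
  by apply/ffunP=> i; rewrite !ffunE mulnA [l * 2]mulnC addnAC.
exact: eq_twist.
Qed.

Lemma even_translate b p z : even_point b p -> even_point b (translate p z).
Proof. by move=> ep i; rewrite !ffunE oddD -mulnA mul2n odd_double addbF; apply: ep. Qed.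

Lemma even_lfold b p : even_point b p -> even_point (~~ b) (lfold p).
Proof.
move=> ep i; move: (ep i); rewrite ffunE; case: (p.2 i) => [|k] /=.
  by move=> <-.
by move=> <-; rewrite !negbK.
Qed.

Lemma ladj_translate p q z : ladj p q -> ladj (translate p z) (translate q z).
Proof. by move=> h; apply: padj_shift. Qed.

Lemma potential_shift_adj p p' q z : ladj p q -> ladj p' q ->
  even_point true p -> even_point true p' -> even_point false q ->
  potential true (translate p z) (+) potential true p =
  potential true (translate p' z) (+) potential true p'.
Proof.
move=> h h' ep ep' eq.
have := potential_link2 h h' ep ep' eq.
have := potential_link2 (ladj_translate z h) (ladj_translate z h')
  (even_translate z ep) (even_translate z ep') (even_translate z eq).
rewrite !link_shift => ->; move: (potential _ _) (potential _ _) (potential _ _)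
  (potential _ _); by do 4![case].
Qed.

(** Links are invariant under translation, so the period of the potential does not change between
    two even points with a common neighbour. Folding an even number of times leads from [p] to the
    origin and replaces its label by [s0]. *)
Lemma potential_shift p z : even_point true p ->
  potential true (translate p z) (+) potential true p =
  potential true (translate (s0, pconst 0) z) (+) potential true (s0, pconst 0).
Proof.
move=> ep; have [k ->] : exists k, (s0, pconst 0) = iter k.*2 lfold p.
  exists (pot_height p)./2; have ev : ~~ odd (pot_height p) by rewrite /= odd_double.
  rewrite even_halfK // (iter_lfold_const _ ev (pot_height_ge p) ep) //.
elim: k p ep => [|k IH] p ep //; rewrite doubleS 2!iterSr -IH; last first.
  exact: even_lfold (even_lfold ep).
apply: (@potential_shift_adj _ _ (lfold p)) => //; first exact: padj_fold.
- exact: padjC (padj_fold _).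
- exact: even_lfold (even_lfold ep).
- exact: (even_lfold ep).
Qed.

Definition orbit_point (s : W) (k : nat) (S : {set D}) : lpoint :=
  (s, pscale k (pind S)).

(* The integral of [link] along the loop that moves the coordinates in [S] once
   around the torus: the class of the polymorphism on [S]. *)
Definition loop (s : W) (S : {set D}) : bool :=
  let odd_point j := (s, padd (pscale (2 * j) (pind S)) (pconst 1)) in
  \big[addb/false]_(j < l)
    (link (orbit_point s (2 * j) S) (odd_point j) (+)
     link (orbit_point s (2 * j.+1) S) (odd_point j)).

Lemma even_orbit_point s k S : even_point true (orbit_point s (2 * k) S).
Proof. by move=> i; rewrite !ffunE /= -mulnA mul2n odd_double. Qed.

(** The links along the loop telescope to a period of the potential. This period does not involve
    the label [s]: homotopic polymorphisms have the same class. *)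
Lemma loopE s S : loop s S =
  potential true (translate (s0, pconst 0) (pind S)) (+) potential true (s0, pconst 0).
Proof.
have e0 : even_point true (s, @pconst D 0) by move=> i; rewrite ffunE.
rewrite -(potential_shift _ e0) /loop.
have -> : translate (s, pconst 0) (pind S) = orbit_point s (2 * l) S.
  by congr pair; apply/ffunP=> i; rewrite !ffunE.
have -> : (s, pconst 0) = orbit_point s (2 * 0) S.
  by congr pair; apply/ffunP=> i; rewrite !ffunE.
rewrite addbC -(addb_telescope (fun j => potential true (orbit_point s (2 * j) S))).
apply: eq_bigr => j _; apply: potential_link2; rewrite ?/ladj /=.
- by move=> i; rewrite !ffunE; lia.
- by move=> i; rewrite !ffunE; case: (i \in S); lia.
- exact: even_orbit_point.
- exact: even_orbit_point.
- by move=> i; rewrite !ffunE oddD -mulnA mul2n odd_double.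
Qed.

Lemma loop_setU1 s i (S : {set D}) : i \notin S -> loop s (i |: S) = loop s [set i] (+) loop s S.
Proof.
move=> iS; rewrite !loopE; set z := (s0, _).
have e0 : even_point true z by move=> j; rewrite ffunE.
rewrite -/z -(potential_shift (pind [set i]) (even_translate (pind S) e0)).
have -> : translate (translate z (pind S)) (pind [set i]) = translate z (pind (i |: S)).
  congr pair; apply/ffunP=> j; rewrite !ffunE !inE.
  by case: eqP iS => [-> /negbTE -> | _ _] /=; lia.
by move: (potential _ _) (potential _ _) (potential _ _); do 3![case].
Qed.

Lemma loop_set0 s : loop s set0 = false.
Proof.
rewrite loopE; set z := (s0, _).
rewrite (_ : translate z _ = z) ?addbb //.
by congr pair; apply/ffunP=> j; rewrite !ffunE inE muln0.
Qed.

Lemma loop_sum s S : loop s S = \big[addb/false]_(i in S) loop s [set i].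
Proof.
elim: {S}#|S| {-2}S (erefl #|S|) => [|n IH] S.
  by move/eqP; rewrite cards_eq0 => /eqP ->; rewrite big_set0 loop_set0.
move=> cS; have [E|[i iS]] := set_0Vmem S; first by rewrite E cards0 in cS.
rewrite (big_setD1 i iS) /= -IH; first by rewrite -loop_setU1 ?setD1K // !inE eqxx.
by have := cardsD1 i S; rewrite iS cS add1n => -[<-].
Qed.

Lemma big_addb_double (F : nat -> bool) n :
  \big[addb/false]_(j < n) (F (2 * j) (+) F (2 * j).+1) =
  \big[addb/false]_(k < n + n) F k.
Proof.
rewrite addnn; elim: n => [|n IH]; first by rewrite !big_ord0.
by rewrite doubleS !big_ord_recr /= IH mul2n addbA.
Qed.

(** Along the diagonal all walks are shifts of one closed walk [c], so every face is degenerate and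
    only the [cut] terms remain. They run through [c] twice, with opposite orientations because [l]
    is odd. By [cut_swap] each edge contributes 1 plus a telescoping term, and the total is [l] mod
    2. *)
Lemma loop_setT s : loop s setT = true.
Proof.
pose c k := colour (s, pconst k).
have cl k : c (l + k) = c k.
  rewrite addnC; have := diag_periodic (s, pconst 0) k; rewrite /diag /c /=.
  have E m : padd (pconst 0) (pconst m) = @pconst D m.
    by apply/ffunP=> i; rewrite !ffunE.
  by rewrite !E.
have c4 k : c k < 4 by apply: colour_lt.
have cN k : c k != c k.+1.
  by apply: colour_adj => i; rewrite !ffunE; right.
pose F k := if odd k then cut (c k.+1) (c k) else cut (c k) (c k.+1).
have -> : loop s setT = \big[addb/false]_(j < l) (F (2 * j) (+) F (2 * j).+1).
  apply: eq_bigr => j _.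
  have d1 m : diag (orbit_point s m setT) =1 (fun k => c (m + k)).
    move=> k; rewrite /diag /c; congr (colour (_, _)).
    by apply/ffunP=> i; rewrite !ffunE inE muln1.
  have d2 m : diag (s, padd (pscale m (pind setT)) (pconst 1)) =1 (fun k => c (m + k).+1).
    move=> k; rewrite /diag /c; congr (colour (_, _)).
    by apply/ffunP=> i; rewrite !ffunE inE muln1 addn1.
  rewrite /link !(eq_twist _ (d1 _) (d2 _)) /twist !addn0 /F /= !mul2n doubleS odd_double /=.
  rewrite !big1 ?addbF // => [k _|k _]; rewrite /face !addnS; case: odd;
    by rewrite /corner ?eqxx ?andbF.
rewrite big_addb_double big_split_ord /= -big_split /=.
transitivity (\big[addb/false]_(k < l) ((c k == 3) (+) (c k.+1 == 3) (+) true)).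
  apply: eq_bigr => k _; rewrite /F oddD odd_l -addnS !cl.
  have E := cut_swap (c4 k) (c4 k.+1) (cN k).
  transitivity ((c k != 3) && (c k.+1 != 3)); first by rewrite -E; case: odd; rewrite // addbC.
  by case: (c k =P 3) (cN k) => [->|_]; case: (c k.+1 =P 3) => [->|_].
have cl0 : c l = c 0 by rewrite -(cl 0) addn0.
rewrite big_split /= (addb_telescope (fun k => c k == 3)) cl0 addbb /=.
by rewrite big_const_ord -[RHS]odd_l; elim: (l) => // n ->.
Qed.

End Cochain.

(** * Noise stability of antiperiodic functions *)

Section Noise.
Import Order.TTheory GRing.Theory Num.Theory.
Local Open Scope ring_scope.

Lemma cauchy_schwarz_card (I : finType) (d : I -> int) :
  (\sum_i d i) ^+ 2 <= #|I|%:R * \sum_i d i ^+ 2.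
Proof.
have : 0 <= \sum_i \sum_j (d i - d j) ^+ 2.
  by apply: sumr_ge0 => i _; apply: sumr_ge0 => j _; apply: sqr_ge0.
have -> : \sum_i \sum_j (d i - d j) ^+ 2 =
    (#|I|%:R * \sum_i d i ^+ 2 - (\sum_i d i) ^+ 2) *+ 2.
  transitivity (\sum_i (#|I|%:R * d i ^+ 2 + \sum_j d j ^+ 2
       - 2 * (d i * \sum_j d j))).
    apply: eq_bigr => i _.
    have -> : #|I|%:R * d i ^+ 2 = \sum_(j : I) d i ^+ 2.
      by rewrite sumr_const mulr_natl.
    rewrite !mulr_sumr -big_split -sumrB /=; apply: eq_bigr => j _; ring.
  rewrite sumrB big_split /= -!mulr_sumr -mulr_suml sumr_const.
  rewrite mulr2n -[X in _ = X]mulr2n -mulr_natl; ring.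
by rewrite pmulrn_lge0 // subr_ge0.
Qed.

Variables (D : finType) (l : nat).
Hypothesis l_gt1 : (1 < l)%N.
Let l_gt0 : (0 < l)%N. Proof. exact: ltnW. Qed.

Local Notation point := (point D).
Definition pstep (k : nat) (z : point) (i : D) : point :=
  padd z (pscale k (pind [set i])).

Definition box_point (z : {ffun D -> 'I_l}) : point := [ffun i => val (z i)].

Definition box_sum (F : point -> int) : int :=
  \sum_(z : {ffun D -> 'I_l}) F (box_point z).

Lemma pstepE k z i j : pstep k z i j = (z j + k * (j == i))%N.
Proof. by rewrite !ffunE !inE. Qed.

Lemma box_sum_step (F : point -> int) i :
  (forall z, F (pstep l z i) = F z) ->
  box_sum (fun z => F (pstep 1 z i)) = box_sum F.
Proof.
move=> perF; pose s (z : {ffun D -> 'I_l}) : {ffun D -> 'I_l} :=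
  [ffun j => if j == i then ordS (z j) else z j].
have s_inj : injective s.
  move=> z z' /ffunP E; apply/ffunP=> j; move: (E j); rewrite !ffunE.
  by case: eqP => // _ /(can_inj (@ordSK _)).
rewrite /box_sum [RHS](reindex_inj s_inj); apply: eq_bigr => z _.
have [E|/eqP zi] := eqVneq (z i).+1 l; last first.
  congr F; apply/ffunP=> j; rewrite pstepE !ffunE; case: eqP => [->|_] /=.
    by rewrite modn_small ?muln1 ?addn1 // ltn_neqAle ltn_ord andbT; apply/eqP.
  by rewrite muln0 addn0.
rewrite -[RHS]perF; congr F; apply/ffunP=> j; rewrite !pstepE !ffunE.
case: eqP => [->|_] /=; last by rewrite !muln0.
by rewrite E modnn !muln1 add0n addn1.
Qed.

Lemma pstepD j k z i : pstep j (pstep k z i) i = pstep (j + k) z i.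
Proof. by apply/ffunP=> a; rewrite !pstepE; lia. Qed.

Lemma pstepC j k z a b : pstep j (pstep k z a) b = pstep k (pstep j z b) a.
Proof. by apply/ffunP=> c; rewrite !pstepE; lia. Qed.

Lemma box_sum_steps (F : point -> int) i k :
  (forall z, F (pstep l z i) = F z) ->
  box_sum (fun z => F (pstep k z i)) = box_sum F.
Proof.
move=> perF; elim: k => [|k IH].
  by apply: eq_bigr => z _; congr F; apply/ffunP=> j; rewrite pstepE addn0.
rewrite -IH -(box_sum_step (F := fun z => F (pstep k z i)) (i := i)); last first.
  by move=> z; rewrite pstepC perF.
by apply: eq_bigr => z _; rewrite pstepD addn1.
Qed.

(* The spectral gap of the averaging operator on functions that change sign
   over one period, obtained from a discrete Poincare inequality. *)
Lemma antiperiodic_gap (h : point -> int) i :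
  (forall z, h (pstep l z i) = - h z) ->
  (l ^ 2)%:R * box_sum (fun z => (h z + h (pstep 1 z i)) ^+ 2) <=
  (4 * l ^ 2 - 4)%:R * box_sum (fun z => h z ^+ 2).
Proof.
move=> anti; pose d z := h (pstep 1 z i) - h z.
have per_d z : d (pstep l z i) ^+ 2 = d z ^+ 2.
  by rewrite /d pstepC !anti; ring.
(* Over one period the differences [d] add up to [- 2 * h]. Cauchy-Schwarz contributes one factor
   [l], and summing the [l] shifts over the box contributes the other. *)
have poincare : 4 * box_sum (fun z => h z ^+ 2) <=
    (l ^ 2)%:R * box_sum (fun z => d z ^+ 2).
  have -> : (l ^ 2)%:R * box_sum (fun z => d z ^+ 2) =
      box_sum (fun z => l%:R * \sum_(k < l) d (pstep k z i) ^+ 2).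
    have E : \sum_(k < l) box_sum (fun z => d (pstep k z i) ^+ 2) =
        l%:R * box_sum (fun z => d z ^+ 2).
      rewrite (eq_bigr (fun=> box_sum (fun z => d z ^+ 2))); last first.
        by move=> k _; apply: (box_sum_steps k per_d).
      by rewrite sumr_const card_ord mulr_natl.
    by rewrite natrX expr2 -mulrA -E /box_sum -mulr_sumr exchange_big.
  rewrite mulr_sumr; apply: ler_sum => z _.
  have := cauchy_schwarz_card (fun k : 'I_l => d (pstep k (box_point z) i)).
  rewrite card_ord; have -> : \sum_(k < l) d (pstep k (box_point z) i) = - 2 * h (box_point z).
    set w := box_point z.
    have tele n : \sum_(k < n) d (pstep k w i) = h (pstep n w i) - h (pstep 0 w i).
      elim: n => [|n IH]; first by rewrite big_ord0 subrr.
      by rewrite big_ord_recr /= IH /d pstepD add1n; ring.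
    rewrite tele anti; have -> : pstep 0 w i = w; last by ring.
    by apply/ffunP=> j; rewrite pstepE addn0.
  by rewrite exprMn sqrrN.
(* The parallelogram law turns the lower bound for differences into an upper bound for sums. *)
have sumE : box_sum (fun z => (h z + h (pstep 1 z i)) ^+ 2) =
    4 * box_sum (fun z => h z ^+ 2) - box_sum (fun z => d z ^+ 2).
  have h2 : box_sum (fun z => h (pstep 1 z i) ^+ 2) = box_sum (fun z => h z ^+ 2).
    by apply: (box_sum_step (F := fun z => h z ^+ 2)) => z; rewrite anti sqrrN.
  transitivity (2 * box_sum (fun z => h z ^+ 2) +
    2 * box_sum (fun z => h (pstep 1 z i) ^+ 2) - box_sum (fun z => d z ^+ 2)).
    rewrite /box_sum !mulr_sumr -big_split -sumrB /=.
    by apply: eq_bigr => z _; rewrite /d; ring.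
  by rewrite h2; ring.
rewrite sumE; move: poincare; move: (box_sum _) (box_sum _) => X Y; lia.
Qed.

Fixpoint subcube (s : seq D) (z : point) : seq point :=
  if s is i :: s' then subcube s' z ++ subcube s' (pstep 1 z i) else [:: z].

Lemma size_subcube s z : size (subcube s z) = (2 ^ size s)%N.
Proof.
by elim: s z => //= i s IH z; rewrite size_cat !IH addnn expnS mul2n.
Qed.

Lemma subcube_pstep k s z i :
  subcube s (pstep k z i) = [seq pstep k p i | p <- subcube s z].
Proof. by elim: s z => //= j s IH z; rewrite map_cat -!IH pstepC. Qed.

Lemma subcube_box s z p : uniq s -> p \in subcube s z ->
  forall i, (z i <= p i <= z i + (i \in s))%N.
Proof.
elim: s z => [|j s IH] z /=; first by rewrite inE => _ /eqP -> i; rewrite addn0 leqnn.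
case/andP=> js us; rewrite mem_cat => /orP[] /(IH _ us) h i; move: (h i).
  by rewrite inE; case: eqP => //=; lia.
rewrite !pstepE inE; case: eqP => [->|_] /=; last by rewrite muln0 addn0.
by rewrite (negbTE js); lia.
Qed.

Definition subcube_sum (s : seq D) (h : point -> int) (z : point) : int :=
  \sum_(p <- subcube s z) h p.

(** Iterates [antiperiodic_gap] one direction at a time, since the sum over a subcube is again
    antiperiodic in the remaining directions. *)
Lemma subcube_gap (s : seq D) (h : point -> int) :
  (forall i z, i \in s -> h (pstep l z i) = - h z) ->
  ((l ^ 2) ^ size s)%:R * box_sum (fun z => subcube_sum s h z ^+ 2) <=
  ((4 * l ^ 2 - 4) ^ size s)%:R * box_sum (fun z => h z ^+ 2).
Proof.
elim: s => [|i s IH] anti.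
  rewrite !expn0 !mul1r; apply: ler_sum => z _.
  by rewrite /subcube_sum /= big_seq1.
have antis j z : j \in s -> h (pstep l z j) = - h z.
  by move=> js; apply: anti; rewrite inE js orbT.
have := @antiperiodic_gap (subcube_sum s h) i.
have -> : box_sum (fun z => (subcube_sum s h z + subcube_sum s h (pstep 1 z i)) ^+ 2)
     = box_sum (fun z => subcube_sum (i :: s) h z ^+ 2).
  by apply: eq_bigr => z _; rewrite /subcube_sum /= big_cat.
move=> gap.
have expE (a : nat) : (a ^ size (i :: s))%:R = a%:R * (a ^ size s)%:R :> int.
  by rewrite -natrM -expnS.
rewrite !expE -!mulrA mulrCA; apply: (le_trans (ler_wpM2l _ (gap _))); first exact: ler0n.
  move=> z; rewrite /subcube_sum subcube_pstep big_map -sumrN.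
  by apply: eq_bigr => p _; rewrite anti ?mem_head.
by rewrite mulrCA; apply: ler_wpM2l; [exact: ler0n | exact: IH].
Qed.

(* On every unit cube [G] is a function of [kappa], so averaging the signed
   indicators of the classes of [kappa] over cubes retains a [1 / #|K|] fraction of
   their squared norm, while each direction in [S] shrinks it by [1 - 1 / l ^ 2]. *)
Lemma noise_bound (K : finType) (S : {set D}) (G : point -> bool) (kappa : point -> K) :
  (forall i z, i \in S -> G (pstep l z i) = ~~ G z) ->
  (forall i z, i \in S -> kappa (pstep l z i) = kappa z) ->
  (forall w p q : point, (forall i, w i <= p i <= (w i).+1)%N ->
     (forall i, w i <= q i <= (w i).+1)%N -> kappa p = kappa q -> G p = G q) ->
  (#|S| <= #|K| * l ^ 2)%N.
Proof.
move=> antiG perK local.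
pose h (c : K) (z : point) : int := if kappa z == c then (-1) ^+ G z else 0.
have h_anti c i z : i \in enum S -> h c (pstep l z i) = - h c z.
  rewrite mem_enum => iS; rewrite /h perK // antiG //.
  by case: eqP => _; [case: (G z) | rewrite oppr0].
have gap : ((l ^ 2) ^ #|S|)%:R *
     (\sum_(c : K) box_sum (fun z => subcube_sum (enum S) (h c) z ^+ 2)) <=
     ((4 * l ^ 2 - 4) ^ #|S|)%:R * (\sum_(c : K) box_sum (fun z => h c z ^+ 2)).
  rewrite !mulr_sumr; apply: ler_sum => c _.
  by have := subcube_gap (h_anti c); rewrite -cardE.
pose N := #|{ffun D -> 'I_l}|.
have sum_h : \sum_(c : K) box_sum (fun z => h c z ^+ 2) = N%:R.
  rewrite /box_sum exchange_big /= /N -sumr_const; apply: eq_bigr => z _.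
  rewrite (bigD1 (kappa (box_point z))) //= big1 ?addr0 => [|c /negbTE].
    by rewrite /h eqxx sqrr_sign.
  by rewrite /h eq_sym => ->; rewrite expr0n.
(* Within a cube the points of one class have equal signs, so the squared sum is the squared class
   size. The class sizes add up to [2 ^ #|S|], and Cauchy-Schwarz over [K] applies. *)
have low : ((4 ^ #|S|) * N)%:R <= #|K|%:R *
   (\sum_(c : K) box_sum (fun z => subcube_sum (enum S) (h c) z ^+ 2)) :> int.
  rewrite /box_sum exchange_big /= mulr_sumr natrM /N -sumr_const mulr_sumr.
  apply: ler_sum => z _; set P := subcube (enum S) (box_point z).
  have count_sq c : subcube_sum (enum S) (h c) (box_point z) ^+ 2 =
     ((count (fun p => kappa p == c) P)%:R) ^+ 2 :> int.
    have [/hasP[p0 p0P p0c]|] := boolP (has (fun p => kappa p == c) P); last first.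
      rewrite has_count -leqNgt leqn0 => /eqP E; rewrite E /subcube_sum big_seq big1 //.
      move=> p pP; rewrite /h; case: eqP => // pc.
      by move/eqP: E; rewrite -leqn0 leqNgt -has_count; case/hasP; exists p => //; apply/eqP.
    have sgn p : p \in P -> h c p = (-1) ^+ G p0 * (kappa p == c)%:R.
      move=> pP; rewrite /h; case: eqP => [pc|_]; last by rewrite mulr0.
      rewrite mulr1; congr (_ ^+ (nat_of_bool _)).
      have inbox q : q \in P -> forall i,
          (box_point z i <= q i <= (box_point z i).+1)%N.
        move=> qP i; have := subcube_box (enum_uniq _) qP i.
        by case: (i \in _); lia.
      by apply: (local (box_point z)); [exact: inbox | exact: inbox | rewrite pc (eqP p0c)].
    rewrite /subcube_sum -/P big_seq (eq_bigr _ sgn) -big_seq -mulr_sumr exprMn.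
    by rewrite sqrr_sign mul1r -natr_sum -sum1_count [in RHS]big_mkcond.
  have total : \sum_c (count (fun p => kappa p == c) P)%:R = (2 ^ #|S|)%:R :> int.
    rewrite -natr_sum; congr (_%:R); rewrite cardE -(size_subcube (enum S) (box_point z)).
    rewrite -/P -sum1_size (eq_bigr (fun c => \sum_(p <- P) (kappa p == c : nat)))%N.
      rewrite exchange_big /=; apply: eq_bigr => p _.
      by rewrite (bigD1 (kappa p)) //= eqxx big1 // => c /negbTE; rewrite eq_sym => ->.
    by move=> c _; rewrite -sum1_count big_mkcond.
  have := cauchy_schwarz_card (fun c => (count (fun p => kappa p == c) P)%:R : int).
  rewrite total (eq_bigr _ (fun c _ => esym (count_sq c))) mulr1 natrX -exprM mulnC.
  by rewrite exprM natrX.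
have N_gt0 : (0 < N)%N by rewrite /N card_ffun card_ord expn_gt0 l_gt0.
have main : ((l ^ 2) ^ #|S| * (4 ^ #|S| * N) <= #|K| * ((4 * l ^ 2 - 4) ^ #|S| * N))%N.
  rewrite -(ler_nat int) natrM.
  apply: (le_trans (ler_wpM2l (ler0n _ _) low)).
  by rewrite mulrCA natrM; apply: ler_wpM2l; rewrite ?ler0n // natrM -sum_h.
rewrite mulnA (mulnA #|K|) leq_pmul2r // in main.
have E4 : (4 * l ^ 2 - 4 = 4 * (l ^ 2).-1)%N by rewrite -subn1 mulnBr muln1.
rewrite E4 expnMn mulnC mulnCA leq_pmul2l ?expn_gt0 // in main.
set a := (l ^ 2).-1 in main.
have aE : (l ^ 2 = a.+1)%N by rewrite prednK // expn_gt0 l_gt0.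
have a_gt0 : (0 < a)%N by move: l_gt1 aE; case: (l) => [|[|k]] //; rewrite -mulnn; lia.
rewrite aE in main *.
(* Bernoulli's inequality for [(1 + 1 / a) ^ m] with denominators cleared; together with [main] it
   bounds [#|S|]. *)
have bernoulli m : (a ^ m * (a + m) <= a * a.+1 ^ m)%N.
  elim: m => [|m IH]; first by rewrite !expn0 mul1n addn0 muln1.
  rewrite !expnS; have := leq_mul (leqnn a.+1) IH; nia.
have := leq_trans (bernoulli #|S|) (leq_mul (leqnn a) main).
rewrite (mulnC #|K|) mulnCA leq_pmul2l ?expn_gt0 ?a_gt0 // => le_aS.
by rewrite mulnS; nia.
Qed.

End Noise.

(** * Selecting boundedly many coordinates *)

Lemma big_addb_exists (I : finType) (A : {set I}) (F : I -> bool) :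
  \big[addb/false]_(i in A) F i -> exists2 i, i \in A & F i.
Proof.
move=> h; apply/exists_inP; apply: contraLR h => /exists_inPn h.
by rewrite big1 // => i iA; apply/negbTE/h.
Qed.

Section Selection.
Variable l : nat.
Hypotheses (l_gt1 : 1 < l) (odd_l : odd l).
Let l_gt0 : 0 < l := ltnW l_gt1.

Definition torus_hom (D : finType) (f : torus D l -> 'I_4) :=
  forall x y, torus_adj x y -> f x != f y.

Definition selection (D : finType) (f : torus D l -> 'I_4) : {set D} :=
  [set i | loop l_gt0 (fun _ : unit => f) tt [set i]].

Section Arity.
Variables (D : finType) (f : torus D l -> 'I_4).
Hypothesis f_hom : torus_hom f.

Let F (_ : unit) := f.
Let F_hom (s s' : unit) x y : torus_adj x y -> F s x != F s' y.
Proof. exact: f_hom. Qed.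

Lemma selection_neq0 : exists i, i \in selection f.
Proof.
have := loop_setT l_gt0 odd_l F_hom tt; rewrite (loop_sum _ odd_l F_hom tt).
by case/big_addb_exists => i _ h; exists i; rewrite inE.
Qed.

(** [noise_bound] is applied to the potential at the even points [2 z], where [l] steps in [z] make
    one translation, and to the [l] colours on the diagonal through [2 z]. The even points of a cube
    share an odd neighbour; if their diagonals agree, so do their links to it, and hence their
    potentials. *)
Lemma card_selection : #|selection f| <= 4 ^ l * l ^ 2.
Proof.
pose even z : unit * point D := (tt, pscale 2 z).
pose G z := potential l_gt0 F tt true (even z).
pose kappa z : {ffun 'I_l -> 'I_4} :=
  [ffun k : 'I_l => f (residue l_gt0 (padd (pscale 2 z) (pconst k)))].
have e_even z : even_point true (even z).
  by move=> i; rewrite !ffunE mul2n odd_double.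
have shiftE z i : even (pstep l z i) = translate l (even z) (pind [set i]).
  by congr pair; apply/ffunP=> j; rewrite !ffunE; lia.
have <- : #|{ffun 'I_l -> 'I_4}| = 4 ^ l by rewrite card_ffun !card_ord.
apply: (noise_bound (G := G) (kappa := kappa) l_gt1).
- move=> i z; rewrite inE => h; rewrite /G shiftE.
  have := potential_shift l_gt0 odd_l F_hom tt (pind [set i]) (e_even z).
  rewrite -(loopE _ odd_l F_hom tt tt) h.
  by do 2![case: (potential _ _ _ _ _)].
- move=> i z _; apply/ffunP=> k; rewrite !ffunE; congr f.
  rewrite -[RHS](residue_periodic _ _ (pscale 2 (pind [set i]))); congr residue.
  by apply/ffunP=> j; rewrite !ffunE; lia.
- move=> w p q wp wq E.
  pose o : unit * point D := (tt, padd (pscale 2 w) (pconst 1)).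
  have adj (z : point D) : (forall i, w i <= z i <= (w i).+1) -> ladj (even z) o.
    by move=> h i; move: (h i); rewrite !ffunE; lia.
  have eo : even_point false o by move=> i; rewrite !ffunE oddD mul2n odd_double.
  have := potential_link2 l_gt0 odd_l F_hom tt (adj _ wp) (adj _ wq) (e_even p) (e_even q) eo.
  have D1 : diag l_gt0 F (even p) =1 diag l_gt0 F (even q).
    have dmod z k : diag l_gt0 F (even z) k = kappa z (modl l_gt0 k).
      rewrite ffunE /diag /colour /=; congr (nat_of_ord (f _)).
      rewrite -[RHS](residue_periodic _ _ (pconst (k %/ l))); congr residue.
      apply/ffunP=> j; rewrite !ffunE -addnA; congr (_ + _).
      by rewrite addnC mulnC -divn_eq.
    by move=> k; rewrite !dmod E.
  rewrite /link (eq_twist _ D1 (fun=> erefl)) addbb.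
  by rewrite /G; do 2![case: (potential _ _ _ _ _)].
Qed.

End Arity.

Lemma eq_loop (D : finType) (W W' : Type) (F : W -> torus D l -> 'I_4)
    (F' : W' -> torus D l -> 'I_4) s s' S :
  F s =1 F' s' -> loop l_gt0 F s S = loop l_gt0 F' s' S.
Proof.
move=> E; apply: eq_bigr => j _.
have Ed x : diag l_gt0 F (s, x) =1 diag l_gt0 F' (s', x).
  by move=> k; rewrite /diag /colour /= E.
by rewrite /link !(eq_twist _ (Ed _) (Ed _)).
Qed.

(** Two labels combine [f'] and the minor of [f] into one family [F], so their loops agree. The loop
    of the minor around [j] is the loop of [f] around the fibre of [g] over [j]; being the sum of
    its single loops, it is nonzero only if the fibre meets the selection. *)
Lemma selection_minor (D D' : finType) (g : D -> D')
    (f : torus D l -> 'I_4) (f' : torus D' l -> 'I_4) :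
  torus_hom f -> torus_hom f' ->
  (forall y z : torus D' l, torus_adj y z -> f' y != f [ffun i => z (g i)]) ->
  selection f' \subset g @: selection f.
Proof.
move=> f_hom f'_hom near.
pose F (b : bool) (y : torus D' l) := if b then f' y else f [ffun i => y (g i)].
have adjC y z : @torus_adj D' l y z -> torus_adj z y.
  by move=> h i; rewrite cycle_rel_sym; apply: h.
have F_hom s s' y z : torus_adj y z -> F s y != F s' z.
  move=> h; case: s; case: s' => /=; first exact: f'_hom.
  - exact: near.
  - by rewrite eq_sym; apply/near/adjC.
  - by apply: f_hom => i; rewrite !ffunE; apply: h.
pose F1 (_ : unit) := f.
have F1_hom (s s' : unit) x y : torus_adj x y -> F1 s x != F1 s' y by apply: f_hom.
have pull S : loop l_gt0 F false S = loop l_gt0 F1 tt (g @^-1: S).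
  have Ed x : diag l_gt0 F (false, x) =1 diag l_gt0 F1 (tt, [ffun i => x (g i)]).
    move=> k; rewrite /diag /colour /F1 /=; congr (nat_of_ord (f _)).
    by apply/ffunP=> i; rewrite !ffunE; apply: val_inj.
  apply: eq_bigr => j _; rewrite /link !(eq_twist _ (Ed _) (Ed _)).
  congr (_ (+) _); apply: eq_twist => k; congr (colour _ _ (_, _));
    by apply/ffunP=> i; rewrite !ffunE inE.
apply/subsetP=> j; rewrite inE.
rewrite (@eq_loop _ _ _ _ F tt true) // (loopE _ odd_l F_hom true true).
rewrite -(loopE _ odd_l F_hom true false) pull (loop_sum _ odd_l F1_hom tt).
case/big_addb_exists => i; rewrite !inE => /eqP gi h.
by apply/imsetP; exists i; rewrite ?inE.
Qed.

End Selection.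

(** * The combinatorial gap reduction *)

Section Rounding.
Variables (V Gam : finType) (q K C : nat).
Variable ok : {ffun 'I_q -> V} -> {ffun 'I_q -> Gam} -> bool.

Local Notation scope := {ffun 'I_K -> V}.
Local Notation assignment := {ffun 'I_K -> Gam}.

Definition pull T (U : {ffun 'I_K -> T}) (m : nat) (j : 'I_m -> 'I_K) :
  {ffun 'I_m -> T} := [ffun i => U (j i)].

Definition good (U : scope) (s : assignment) : bool :=
  [forall i, forall j, (U i == U j) ==> (s i == s j)] &&
  [forall w : {ffun 'I_q -> 'I_K}, ok (pull U w) (pull s w)].

Definition solution (sigma : {ffun V -> Gam}) : bool :=
  [forall W : {ffun 'I_q -> V}, ok W [ffun a => sigma (W a)]].

Variable sel : scope -> {set assignment}.
Hypothesis sel_good : forall U s, s \in sel U -> good U s.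
Hypothesis sel_neq0 : forall U, exists s, s \in sel U.
Hypothesis card_sel : forall U, #|sel U| <= C.
Hypothesis sel_pull : forall U (j : 'I_K -> 'I_K),
  sel (pull U j) \subset (fun s => pull s j) @: sel U.
Hypotheses (q_gt0 : 0 < q) (leK : 1 + q * C <= K).

Let K_gt0 : 0 < K. Proof. exact: leq_trans leK. Qed.
Let i0 : 'I_K := Ordinal K_gt0.

Definition clip (k : nat) : 'I_K := if insub k is Some i then i else i0.

Let clipE k : k < K -> val (clip k) = k.
Proof. by move=> kK; rewrite /clip insubT. Qed.

Definition supported (m : nat) (U : scope) := forall i : 'I_K, m <= i -> U i = U i0.

Definition extend (m : nat) (U : scope) (W : {ffun 'I_q -> V}) : scope :=
  [ffun i : 'I_K => if insub (i - m) is Some a then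
                      if i < m then U i else W a
                    else if i < m then U i else U i0].

Lemma extend_supported m U W : 0 < m -> supported (m + q) (extend m U W).
Proof.
move=> m0 i mi; rewrite !ffunE /= insubF; last by apply/negbTE; rewrite -leqNgt; lia.
by rewrite ifF ?m0; [case: insub => // | lia].
Qed.

Section Step.
Variables (m : nat) (U : scope).
Hypotheses (m_gt0 : 0 < m) (mqK : m + q <= K) (suppU : supported m U).
Hypothesis stable : forall W, #|sel (extend m U W)| <= #|sel U|.

Let pos (a : 'I_q) : 'I_K := clip (m + a).

Let posE a : val (pos a) = m + a.
Proof. by apply: clipE; have := ltn_ord a; lia. Qed.

(** Pulling back along [j0] restricts an extension to [U]. Pulling back along [j1 a] copies the
    [a]-th new slot onto all new slots, which gives the extension by the single variable [W a]. *)
Let j0 (i : 'I_K) : 'I_K := if i < m then i else i0.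

Let j1 (a : 'I_q) (i : 'I_K) : 'I_K :=
  if i < m then i else if i < m + q then pos a else i0.

Let extend_pos W a : extend m U W (pos a) = W a.
Proof.
rewrite ffunE posE addKn; case: insubP => [b _ E|]; last by rewrite ltn_ord.
by rewrite ifF; [congr (W _); apply: val_inj | lia].
Qed.

Let extend_lt W (i : 'I_K) : i < m -> extend m U W i = U i.
Proof. by move=> im; rewrite ffunE im; case: insub. Qed.

Let pull_j0 W : pull (extend m U W) j0 = U.
Proof.
apply/ffunP=> i; rewrite ffunE /j0; case: ltnP => im; first exact: extend_lt.
by rewrite extend_lt // (suppU im).
Qed.

Let pull_j1 W a : pull (extend m U W) (j1 a) = extend m U [ffun=> W a].
Proof.
apply/ffunP=> i; rewrite ffunE /j1; case: ltnP => im.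
  by rewrite !extend_lt.
case: ltnP => imq.
  rewrite extend_pos ffunE; case: insubP => [b _ E|]; last by case/negP; lia.
  by rewrite ifF ?ffunE //; lia.
rewrite extend_lt // ffunE insubF; last by lia.
by rewrite ifF //; lia.
Qed.

Let card_extend W : #|sel (extend m U W)| = #|sel U|.
Proof.
apply/eqP; rewrite eqn_leq stable /=.
have := subset_leq_card (sel_pull (extend m U W) j0); rewrite pull_j0 => h.
exact: leq_trans h (leq_imset_card _ _).
Qed.

Let pull_sel (U1 : scope) (j : 'I_K -> 'I_K) : #|sel U1| = #|sel (pull U1 j)| ->
  (fun s => pull s j) @: sel U1 = sel (pull U1 j) /\ {in sel U1 &, injective (fun s : assignment => pull s j)}.
Proof.
move=> E; have sub := sel_pull U1 j.
have le1 := leq_imset_card (fun s : assignment => pull s j) (sel U1).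
have E1 : (fun s => pull s j) @: sel U1 = sel (pull U1 j).
  by apply/esym/eqP; rewrite eqEcard sub -E le1.
by split=> //; apply/imset_injP; rewrite E1 E.
Qed.

(* As no extension enlarges the selection, restriction is a bijection between the
   selections, so that a selected assignment on [U] extends uniquely. *)
Lemma stable_solution : exists sigma, solution sigma.
Proof.
have [e eU] := sel_neq0 U.
have lift W : exists2 s, s \in sel (extend m U W) & pull s j0 = e.
  have := subsetP (sel_pull (extend m U W) j0) e; rewrite pull_j0 => /(_ eU).
  by case/imsetP => s sW ->; exists s.
have lift_uniq W s s' : s \in sel (extend m U W) -> s' \in sel (extend m U W) ->
    pull s j0 = e -> pull s' j0 = e -> s = s'.
  move=> sW s'W E E'; have [|_ inj] := @pull_sel (extend m U W) j0.
    by rewrite pull_j0 card_extend.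
  by apply: inj; rewrite // E E'.
pose pick_lift W := if [pick s in sel (extend m U W) | pull s j0 == e] is Some s
                    then s else e.
have pickP W : pick_lift W \in sel (extend m U W) /\ pull (pick_lift W) j0 = e.
  rewrite /pick_lift; case: pickP => [s /andP[sW /eqP]|no] //.
  by have [s sW E] := lift W; have := no s; rewrite sW E eqxx.
pose a0 : 'I_q := Ordinal q_gt0.
(* The value at [v] is read from the unique lift of [e] to the extension of [U] by [v] alone. *)
pose sigma := [ffun v => pick_lift [ffun=> v] (pos a0)].
(* Restricted along [j1 a], the lift for [W] becomes a lift for [W a] alone, so uniqueness makes the
   values agree. *)
have pickE W a : pick_lift W (pos a) = sigma (W a).
  have [sW sE] := pickP W; have [vW vE] := pickP [ffun=> W a].
  have [|E _] := @pull_sel (extend m U W) (j1 a); first by rewrite pull_j1 !card_extend.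
  have s'W : pull (pick_lift W) (j1 a) \in sel (extend m U [ffun=> W a]).
    by rewrite -pull_j1 -E; apply/imsetP; exists (pick_lift W).
  have s'E : pull (pull (pick_lift W) (j1 a)) j0 = e.
    rewrite -[RHS]sE; apply/ffunP=> i; rewrite !ffunE /j0 /j1.
    by case: (ltnP i m) => [->|_] //=; rewrite m_gt0.
  have := lift_uniq _ _ _ s'W vW s'E vE; rewrite ffunE => <-.
  rewrite ffunE /j1 posE ifF; last by lia.
  by rewrite ifT //=; lia.
exists sigma; apply/forallP=> W; have [sW _] := pickP W.
have /andP[_ /forallP/(_ [ffun a => pos a])] := sel_good sW.
set W1 := pull _ _; set W2 := pull _ _.
have pf a : [ffun b => pos b] a = pos a by rewrite ffunE.
have -> : W1 = W by apply/ffunP=> a; rewrite /W1 /pull ffunE pf extend_pos.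
by have -> : W2 = [ffun a => sigma (W a)] by apply/ffunP=> a; rewrite /W2 /pull ffunE pf pickE [RHS]ffunE.
Qed.

End Step.

(** If there is no solution, then by [stable_solution] every scope reached, starting from one
    variable, can be extended by [q] slots to enlarge its selection. After [C] extensions, for which
    [1 + q * C] slots suffice, the selection exceeds [C]. *)
Lemma rounding : V -> exists sigma, solution sigma.
Proof.
move=> v0; have [/existsP //|none] := boolP [exists sigma, solution sigma].
have grow k : k <= C -> exists2 U, supported (1 + q * k) U & k < #|sel U|.
  elim: k => [|k IH] kC.
    exists [ffun=> v0]; first by move=> i _; rewrite !ffunE.
    by have [s sU] := sel_neq0 [ffun=> v0]; rewrite card_gt0; apply/set0Pn; exists s.
  have [U suppU cU] := IH (ltnW kC).
  have m0 : 0 < 1 + q * k by [].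
  have mK : 1 + q * k + q <= K.
    by apply: leq_trans leK; rewrite -addnA -mulnSr leq_add2l leq_mul2l kC orbT.
  have [/existsP[W cW]|] := boolP [exists W, #|sel U| < #|sel (extend (1 + q * k) U W)|].
    exists (extend (1 + q * k) U W); last exact: leq_ltn_trans cW.
    by rewrite mulnSr addnA; apply: extend_supported.
  rewrite negb_exists => /forallP st; case/existsP: none.
  apply: (stable_solution m0 mK suppU) => W.
  by have := st W; rewrite -leqNgt.
have [U _ cU] := grow C (leqnn _).
by have := card_sel U; rewrite leqNgt cU.
Qed.

End Rounding.

(** * The gadget graph over powers of the cycle *)

Section Gadget.
Variables (l : nat) (V Gam : finType) (q K : nat).
Variable ok : {ffun 'I_q -> V} -> {ffun 'I_q -> Gam} -> bool.

Local Notation scope := {ffun 'I_K -> V}.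
Local Notation assignment := {ffun 'I_K -> Gam}.
Local Notation code := {ffun assignment -> 'I_l}.

Definition agree (U U' : scope) (s s' : assignment) : bool :=
  [forall i, forall j, (U i == U' j) ==> (s i == s' j)].

(* Instead of identifying vertices, equality of minors is imposed only up to
   adjacency in the exponential graph, which leaves selections unchanged. *)
Definition gadget_edge (u v : scope * code) : bool :=
  [forall s, forall s', [&& good ok u.1 s, good ok v.1 s' & agree u.1 v.1 s s'] ==>
     cycle_rel (u.2 s) (v.2 s')].

Lemma gadget_edge_sym : symmetric gadget_edge.
Proof.
suff H u v : gadget_edge u v -> gadget_edge v u.
  by move=> u v; apply/idP/idP; apply: H.
move=> /forallP h; apply/forallP=> s; apply/forallP=> s'.
apply/implyP=> /and3P[gs gs' /forallP ag]; rewrite cycle_rel_sym.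
move: (h s') => /forallP/(_ s)/implyP; apply; rewrite gs gs' /=.
apply/forallP=> i; apply/forallP=> j; apply/implyP=> /eqP E.
by move: (ag j) => /forallP/(_ i); rewrite E eqxx eq_sym.
Qed.

(** The restrictions of [sigma] to scopes are good and agree with each other, so evaluating every
    code at the restriction to its scope, a projection on each torus, is a homomorphism. *)
Lemma gadget_complete (sigma : {ffun V -> Gam}) : solution ok sigma ->
  exists phi : scope * code -> 'I_l, forall u v, gadget_edge u v ->
    cycle_rel (phi u) (phi v).
Proof.
move=> sol; pose asg (U : scope) : assignment := [ffun i => sigma (U i)].
have goodU U : good ok U (asg U).
  apply/andP; split.
    by apply/forallP=> i; apply/forallP=> j; apply/implyP=> /eqP E; rewrite !ffunE E.
  apply/forallP=> w; have := forallP sol (pull U w).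
  by congr (ok _ _); apply/ffunP=> a; rewrite !ffunE.
exists (fun u : scope * code => u.2 (asg u.1)) => u v /forallP/(_ (asg u.1))/forallP/(_ (asg v.1)).
rewrite !goodU; move/implyP; apply; apply/forallP=> i; apply/forallP=> j.
by apply/implyP=> /eqP E; rewrite !ffunE E.
Qed.

Hypotheses (l_gt1 : 1 < l) (odd_l : odd l) (q_gt0 : 0 < q).
Hypothesis leK : 1 + q * (4 ^ l * l ^ 2) <= K.
Let l_gt0 : 0 < l := ltnW l_gt1.

Lemma gadget_sound (chi : scope * code -> 'I_4) :
  (forall u v, gadget_edge u v -> chi u != chi v) ->
  V -> exists sigma, solution ok sigma.
Proof.
move=> chi_hom.
pose D (U : scope) := {s | good ok U s}.
(* Coordinates at assignments that are not good get a default value; [gadget_edge] compares good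
   assignments only. *)
pose ext U (y : torus (D U) l) : code :=
  [ffun s => if insub s is Some d then y d else Ordinal l_gt0].
have extE U (y : torus (D U) l) (d : D U) : ext U y (val d) = y d.
  by rewrite ffunE valK.
pose f U (y : torus (D U) l) := chi (U, ext U y).
have f_hom U : torus_hom (f U).
  move=> y z yz; apply: chi_hom; apply/forallP=> s; apply/forallP=> s'.
  apply/implyP=> /= /and3P[gs gs' ag].
  have E : s' = s.
    apply/ffunP=> i; move: ag => /forallP/(_ i)/forallP/(_ i).
    by rewrite eqxx => /eqP.
  by rewrite {s' gs' ag}E -[s]/(val (Sub s gs : D U)) !extE.
pose sel U := val @: selection l_gt1 (f U).
apply: (rounding (sel := sel) (C := 4 ^ l * l ^ 2)) => //.
- by move=> U s /imsetP[d _ ->]; apply: (valP d).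
- move=> U; have [d dU] := selection_neq0 l_gt1 odd_l (f_hom U).
  by exists (val d); apply: imset_f.
- by move=> U; apply: leq_trans (leq_imset_card _ _) (card_selection l_gt1 odd_l (f_hom U)).
move=> U j.
have good_pull (d : D U) : good ok (pull U j) (pull (val d) j).
  have /andP[/forallP h1 /forallP h2] := valP d; apply/andP; split.
    apply/forallP=> a; apply/forallP=> b; rewrite !ffunE.
    by move: (h1 (j a)) => /forallP/(_ (j b)).
  apply/forallP=> w; have := h2 [ffun a => j (w a)].
  by congr (ok _ _); apply/ffunP=> a; rewrite !ffunE.
pose g (d : D U) : D (pull U j) := Sub (pull (val d) j) (good_pull d).
(* An assignment of [pull U j] that agrees with one of [U] is its pullback, so these edges put the
   colouring of the smaller scope next to the minor along [g]. *)
have near y z : torus_adj y z -> f (pull U j) y != f U [ffun d => z (g d)].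
  move=> yz; apply: chi_hom; apply/forallP=> s; apply/forallP=> s'.
  apply/implyP=> /= /and3P[gs gs' ag].
  pose d' : D U := Sub s' gs'.
  have E : s = val (g d').
    apply/ffunP=> i; rewrite ffunE /=; move: ag => /forallP/(_ i)/forallP/(_ (j i)).
    by rewrite ffunE eqxx => /eqP.
  by rewrite E -[s']/(val d') !extE ffunE.
apply/subsetP=> s /imsetP[d dS ->].
have /imsetP[d1 d1S ->] := subsetP (selection_minor l_gt1 odd_l (f_hom U) (f_hom _) near) d dS.
by apply/imsetP; exists (val d1); rewrite ?imset_f.
Qed.

End Gadget.

(** * Turing machines with an odometer *)

Definition digit (B c N : nat) : nat := (N %/ B ^ c) %% B.

Lemma digit0 B c : digit B c 0 = 0.
Proof. by rewrite /digit div0n mod0n. Qed.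

Lemma digit_lt B c N : 0 < B -> digit B c N < B.
Proof. by move=> B0; rewrite ltn_mod. Qed.

Lemma modn_digit B c N : 0 < B -> N %% B ^ c.+1 = digit B c N * B ^ c + N %% B ^ c.
Proof.
move=> B0; have Bc : 0 < B ^ c by rewrite expn_gt0 B0.
rewrite {1}(divn_eq N (B ^ c)) {1}(divn_eq (N %/ B ^ c) B) -/(digit B c N).
rewrite mulnDl -addnA -mulnA -expnS modnMDl modn_small //.
have := digit_lt c N B0; have := ltn_pmod N Bc; rewrite expnS; nia.
Qed.

Lemma low_digits_max B c N : 0 < B ->
  (forall i, i < c -> (digit B i N).+1 = B) <-> (N %% B ^ c).+1 = B ^ c.
Proof.
move=> B0; elim: c => [|c IH]; first by rewrite modn1.
have Bc : 0 < B ^ c by rewrite expn_gt0 B0.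
have dl := digit_lt c N B0; have ml := ltn_pmod N Bc.
rewrite modn_digit // expnS; split=> [h|h].
  have /IH e1 : forall i, i < c -> (digit B i N).+1 = B by move=> i ic; apply: h; apply: ltnW.
  by rewrite -addnS e1 -mulSnr h.
have e1 : (N %% B ^ c).+1 = B ^ c by nia.
have e2 : (digit B c N).+1 = B by nia.
by move=> i; rewrite ltnS leq_eqVlt => /predU1P[-> //|ic]; apply: (proj2 IH).
Qed.

Lemma digit_succ_carry B c N : 0 < B -> (N %% B ^ c).+1 = B ^ c ->
  digit B c N.+1 = if (digit B c N).+1 == B then 0 else (digit B c N).+1.
Proof.
move=> B0 E; have Bc : 0 < B ^ c by rewrite expn_gt0 B0.
have dl := digit_lt c N B0.
have -> : digit B c N.+1 = (digit B c N).+1 %% B.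
  rewrite /digit {1}(divn_eq N (B ^ c)) -addnS E -mulSnr mulnK //.
  by rewrite -[in RHS]addn1 modnDml addn1.
by case: eqP => [->|/eqP ne]; rewrite ?modnn // modn_small // ltn_neqAle ne.
Qed.

Lemma digit_succ_nocarry B c N : 0 < B -> (N %% B ^ c).+1 != B ^ c ->
  digit B c N.+1 = digit B c N.
Proof.
move=> B0 ne; have Bc : 0 < B ^ c by rewrite expn_gt0 B0.
rewrite /digit {1}(divn_eq N (B ^ c)) -addnS divnMDl // [X in _ + X]divn_small ?addn0 //.
by rewrite ltn_neqAle ne ltn_pmod.
Qed.

Lemma digits_all_max B m N : 0 < B -> N < B ^ m ->
  (forall i, i < m -> (digit B i N).+1 = B) <-> N.+1 = B ^ m.
Proof. by move=> B0 Nm; rewrite low_digits_max // modn_small. Qed.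

Section TapeContent.
Variable S : Type.
Implicit Types (t : tape S) (X : nat -> option S).

(* The head scans cell [h] of a tape with contents [X]; cells left of cell [0] are
   never visited. *)
Definition tape_at t (h : nat) X : Prop :=
  (forall p, nth None (tape_right t) p = X (h + p)) /\
  (forall p, p < h -> nth None (tape_left t) p = X (h - p.+1)).

Lemma tape_at_eq t h X Y : X =1 Y -> tape_at t h X -> tape_at t h Y.
Proof. by move=> E [h1 h2]; split=> p => [|hp]; rewrite -E ?h1 ?h2. Qed.

Lemma tape_at_read t h X : tape_at t h X -> tape_read t = X h.
Proof. by case=> h1 _; rewrite -[h]addn0 -h1 nth0. Qed.

Definition update X h a := fun p => if p == h then a else X p.

Lemma tape_at_write t h X a : tape_at t h X -> tape_at (tape_write a t) h (update X h a).
Proof.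
case=> h1 h2; split=> [[|p]|p ph] /=; rewrite /update.
- by rewrite addn0 eqxx.
- by rewrite nth_behead h1 ifF //; apply/eqP; lia.
- by rewrite h2 // ifF //; apply/eqP; lia.
Qed.

Lemma tape_at_moveR t h X : tape_at t h X -> tape_at (tape_move MoveR t) h.+1 X.
Proof.
move=> [h1 h2]; split=> [p|[|p] ph] /=.
- by rewrite nth_behead h1 addSnnS.
- by rewrite (tape_at_read (conj h1 h2)) subn1.
- by rewrite h2 // subSS.
Qed.

Lemma tape_at_moveL t h X : tape_at t h.+1 X -> tape_at (tape_move MoveL t) h X.
Proof.
move=> [h1 h2]; split=> [[|p]|p ph] /=.
- by rewrite -nth0 h2 // subn1 addn0.
- by rewrite h1 addSnnS.
- by rewrite nth_behead h2 //.
Qed.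

Lemma tape_at_keep t h X : tape_at t h X -> tape_at (tape_write (tape_read t) t) h X.
Proof.
move=> a; apply: tape_at_eq (tape_at_write _ a) => p.
by rewrite /update; case: eqP => // ->; apply: tape_at_read.
Qed.

End TapeContent.

Section NthSeq.
Variable S : Type.

Definition shifted (s : seq (option S)) (p : nat) : option S :=
  if p is j.+1 then nth None s j else None.

Lemma tape_at_start (s : seq (option S)) : tape_at (Tape [::] s) 1 (shifted s).
Proof. by split=> [p|[|p]]. Qed.

Lemma nonblank_prefix_eq (s : seq (option S)) (w : seq S) :
  (forall p, nth None s p = nth None (map Some w) p) -> nonblank_prefix s = w.
Proof.
elim: w s => [|a w IH] [|x s] h //=.
- by move: (h 0) => /= ->.
- by move: (h 0).
- by move: (h 0) => /= ->; rewrite (IH s) // => p; apply: (h p.+1).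
Qed.

End NthSeq.

#[local] Arguments tape_move : simpl never.
#[local] Arguments tape_write : simpl never.

Section Odometer.
Variables (k : nat) (Q : finType) (q0 : Q).
Notation m := k.+1.
Notation bits := {ffun 'I_m -> bool}.
Variable delta : Q -> option bool -> bits -> Q.
Variable emit : 'I_3 -> Q -> option bool.

(* A counter is kept ([None]), incremented ([Some false]) or reset
   ([Some true]) during the next sweep to the right. *)
Notation action := {ffun 'I_m -> option bool}.

(** A counter is a single mark on its tape. Incrementing moves the mark one cell to the right, so
    the new bit is the old bit of the previous cell; resetting puts it into the first cell, the one
    without a previous cell. *)
Definition new_bit (a : option bool) (old : bool) (prev : option bool) : bool :=
  match a with
  | None => old
  | Some false => odflt false prev
  | Some true => ~~ isSome prev
  end.

Definition carry (top : bits) : action :=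
  [ffun c : 'I_m => if [forall c' : 'I_m, (c' < c) ==> top c'] then Some (top c) else None].

Definition reset_all : action := [ffun=> Some true].

(** The component in ['I_3] is the pass: all counter values are enumerated three times, once for
    each of the three parts of the output. *)
Definition sweep_state : finType := ('I_3 * action * option bits * Q)%type.
Definition state : finType := (sweep_state + ('I_3 * action) + 'I_3)%type.

Definition sweeping (ps : 'I_3) (a : action) (prev : option bits) (q : Q) : state :=
  inl (inl (ps, a, prev, q)).
Definition rewinding (ps : 'I_3) (a : action) : state := inl (inr (ps, a)).
(** Brings the output head back to the start of the output: state 0 leaves the blank behind the
    word, state 1 runs left to the blank in front of it, and [ord_max] halts. *)
Definition finishing (i : 'I_3) : state := inr i.

Definition role (i : 'I_m.+2) : option (option 'I_m) :=
  if i == ord0 then None else Some (insub i.-1).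

Definition by_role T (xin : T) (xc : 'I_m -> T) (xout : T) : {ffun 'I_m.+2 -> T} :=
  [ffun i => match role i with
             | None => xin | Some None => xout | Some (Some c) => xc c end].

Definition ctape (c : 'I_m) : 'I_m.+2 := inord c.+1.

Lemma role_ctape c : role (ctape c) = Some (Some c).
Proof.
have E : (ctape c : nat) = c.+1 by rewrite inordK // !ltnS ltnW.
rewrite /role -val_eqE /= E; congr Some; rewrite insubT ?ltn_ord // => h.
by congr Some; apply: val_inj.
Qed.

Lemma role_max : role ord_max = Some None.
Proof. by rewrite /role -val_eqE /= insubF // ltnn. Qed.

Lemma by_role_in T (xin : T) xc xout : by_role xin xc xout ord0 = xin.
Proof. by rewrite ffunE. Qed.
Lemma by_role_c T (xin : T) xc xout c : by_role xin xc xout (ctape c) = xc c.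
Proof. by rewrite ffunE role_ctape. Qed.
Lemma by_role_out T (xin : T) xc xout : by_role xin xc xout ord_max = xout.
Proof. by rewrite ffunE role_max. Qed.

Notation cell := (option bool).

Definition next_bits (a : action) (prev : option bits) (xc : {ffun 'I_m -> cell}) : bits :=
  [ffun c : 'I_m => new_bit (a c) (xc c == Some true) (omap (fun b : bits => b c) prev)].

Definition after_sweep (ps : 'I_3) (new : bits) : state :=
  if [forall c, new c]
  then if ps == ord_max then finishing ord0 else rewinding (inord ps.+1) reset_all
  else rewinding ps (carry new).

Definition react (st : state) (x : cell) (xc : {ffun 'I_m -> cell}) (xo : cell) :
    state * {ffun 'I_m.+2 -> cell * move} :=
  let stay := (xo, MoveN) in
  let go mv := by_role (x, mv) (fun c => (xc c, mv)) stay in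
  let out mv := by_role (x, MoveN) (fun c => (xc c, MoveN)) (xo, mv) in
  match st with
  | inl (inl (ps, a, prev, q)) =>
    let new := next_bits a prev xc in
    let q' := delta q x new in
    let put mv := by_role (x, mv) (fun c => (Some (new c), mv)) in
    if x is Some _
    then (sweeping ps a (Some [ffun c => xc c == Some true]) q', put MoveR stay)
    else (after_sweep ps new,
          put MoveL (if emit ps q' is Some b then (Some b, MoveR) else stay))
  | inl (inr (ps, a)) =>
    if xc ord0 is Some _ then (st, go MoveL) else (sweeping ps a None q0, go MoveR)
  | inr i =>
    if i == ord0 then (finishing (inord 1), out MoveL)
    else if xo is Some _ then (st, out MoveL) else (finishing ord_max, out MoveR)
  end.

Definition trans (st : state) (rd : {ffun 'I_m.+2 -> cell}) :=
  react st (rd ord0) [ffun c => rd (ctape c)] (rd ord_max).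

Definition halted : pred state := fun st => if st is inr i then i == ord_max else false.

Definition odometer : tm bool bool :=
  @TM bool bool m.+1 bool id (fun _ _ e => e) id (fun _ _ e => e)
    state (sweeping ord0 reset_all None q0) halted trans.

Section Run.
Variable w : seq bool.
Notation n := (size w).
Notation B := n.+1.

Definition input_at (j : nat) : option bool := nth None (map Some w) j.

Fixpoint run_columns (col : nat -> bits) (j : nat) : Q :=
  if j is i.+1 then delta (run_columns col i) (input_at i) (col i) else q0.

Definition digit_column (N j : nat) : bits := [ffun c : 'I_m => j == digit B c N].

Definition scan (N : nat) : Q := run_columns (digit_column N) B.

(** The [n.+1] cells run alongside the input and the blank after it, so digits are in base [n.+1].
    The blank cell [0] ends the rewinding. *)
Definition counter_cells (v p : nat) : cell :=
  if p is j.+1 then if j <= n then Some (j == v) else None else None.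

Definition in_cells := shifted (map Some w).
Definition out_cells (s : seq bool) := shifted (map Some s).

Record snapshot (st : state) (h : nat) (X : 'I_m -> nat -> cell) (s : seq bool)
    (c : config odometer) : Prop := Snapshot {
  snap_state : cfg_state c = st;
  snap_in : tape_at (cfg_tapes c ord0) h in_cells;
  snap_counter : forall i, tape_at (cfg_tapes c (ctape i)) h (X i);
  snap_out : tape_at (cfg_tapes c ord_max) (size s).+1 (out_cells s)
}.

Lemma input_at_some j : j < n -> exists b, input_at j = Some b.
Proof. by move=> jn; exists (nth false w j); rewrite /input_at (nth_map false). Qed.

Lemma input_at_none j : n <= j -> input_at j = None.
Proof. by move=> jn; rewrite /input_at nth_default // size_map. Qed.

Lemma snapshot_step st h X s c : snapshot st h X s c -> ~~ halted st ->
  let r := react st (in_cells h) [ffun i => X i h] None in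
  tm_step c = @Config _ _ odometer r.1
     [ffun i => tape_move (r.2 i).2 (tape_write (r.2 i).1 (cfg_tapes c i))].
Proof.
case=> e1 e2 e3 e4 nh r; rewrite /tm_step e1 /= (negbTE nh) /trans.
have -> : [ffun i => [ffun j => tape_read (cfg_tapes c j)] (ctape i)] =
    [ffun i => X i h] :> {ffun 'I_m -> cell}.
  by apply/ffunP=> i; rewrite !ffunE (tape_at_read (e3 i)).
rewrite !ffunE (tape_at_read e2) (tape_at_read e4).
have -> : out_cells s (size s).+1 = None by rewrite /= nth_default // size_map.
by rewrite -/r; case: r.
Qed.

Definition write_col (X : 'I_m -> nat -> cell) (j : nat) (b : bits) :=
  fun i => update (X i) j.+1 (Some (b i)).

Definition out_emit (s : seq bool) (e : option bool) := if e is Some b then rcons s b else s.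

Lemma tape_at_emit t s e : tape_at t (size s).+1 (out_cells s) ->
  let a := if e is Some b then (Some b, MoveR) else (None, MoveN) in
  tape_at (tape_move a.2 (tape_write a.1 t)) (size (out_emit s e)).+1 (out_cells (out_emit s e)).
Proof.
move=> at_t; have rd0 : tape_read t = None.
  by rewrite (tape_at_read at_t) /= nth_default // size_map.
case: e => [b|] /=; last by have := tape_at_keep at_t; rewrite rd0.
rewrite size_rcons; apply: tape_at_moveR; apply: tape_at_eq (tape_at_write _ at_t).
case=> [|p]; rewrite /update //= eqSS map_rcons nth_rcons size_map.
by case: ltngtP => // h; rewrite nth_default // size_map ltnW.
Qed.

Lemma tape_at_stay t s : tape_at t (size s).+1 (out_cells s) ->
  tape_at (tape_write None t) (size s).+1 (out_cells s).
Proof. by move=> at_t; apply: (tape_at_emit None at_t). Qed.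

Lemma sweep_step ps a prev q j X s c : j < n ->
  snapshot (sweeping ps a prev q) j.+1 X s c ->
  let new := next_bits a prev [ffun i => X i j.+1] in
  snapshot (sweeping ps a (Some [ffun i => X i j.+1 == Some true])
             (delta q (input_at j) new))
    j.+2 (write_col X j new) s (tm_step c).
Proof.
move=> jn snap new; have [e1 e2 e3 e4] := snap.
rewrite (snapshot_step snap) //= -/new.
have [b E] := input_at_some jn; rewrite -/(input_at j) E.
split=> /=; rewrite 1?ffunE ?by_role_in ?by_role_out /=.
- by congr sweeping; congr Some; apply/ffunP=> i; rewrite !ffunE.
- by apply: tape_at_moveR; rewrite -E -[input_at j]/(in_cells j.+1) -(tape_at_read e2);
    apply: tape_at_keep.
- move=> i; rewrite ffunE by_role_c /=; apply: tape_at_moveR.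
  exact: tape_at_write.
- exact: tape_at_stay.
Qed.

Lemma sweep_last ps a prev q X s c :
  snapshot (sweeping ps a prev q) n.+1 X s c ->
  let new := next_bits a prev [ffun i => X i n.+1] in
  snapshot (after_sweep ps new) n (write_col X n new)
    (out_emit s (emit ps (delta q (input_at n) new))) (tm_step c).
Proof.
move=> snap new; have [e1 e2 e3 e4] := snap.
rewrite (snapshot_step snap) //= -/new -/(input_at n) (input_at_none (leqnn n)).
split=> /=; rewrite 1?ffunE ?by_role_in ?by_role_out //=.
- apply: tape_at_moveL; rewrite -(input_at_none (leqnn n)).
  by rewrite -[input_at n]/(in_cells n.+1) -(tape_at_read e2); apply: tape_at_keep.
- move=> i; rewrite ffunE by_role_c /=; apply: tape_at_moveL.
  exact: tape_at_write.
- exact: tape_at_emit.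
Qed.

Lemma rewind_step ps a h X s c : X ord0 h.+1 <> None ->
  snapshot (rewinding ps a) h.+1 X s c ->
  snapshot (rewinding ps a) h X s (tm_step c).
Proof.
move=> nb snap; have [e1 e2 e3 e4] := snap.
rewrite (snapshot_step snap) //= ffunE; case E: (X ord0 h.+1) => [b|] //.
split=> /=; rewrite 1?ffunE ?by_role_in ?by_role_out //=.
- by apply: tape_at_moveL; have := tape_at_keep e2; rewrite (tape_at_read e2).
- move=> i; rewrite ffunE by_role_c ffunE /=; apply: tape_at_moveL.
  by have := tape_at_keep (e3 i); rewrite (tape_at_read (e3 i)).
- exact: tape_at_stay.
Qed.

Lemma rewind_end ps a X s c : X ord0 0 = None ->
  snapshot (rewinding ps a) 0 X s c ->
  snapshot (sweeping ps a None q0) 1 X s (tm_step c).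
Proof.
move=> E snap; have [e1 e2 e3 e4] := snap.
rewrite (snapshot_step snap) //= ffunE E.
split=> /=; rewrite 1?ffunE ?by_role_in ?by_role_out //=.
- by apply: tape_at_moveR; have := tape_at_keep e2; rewrite (tape_at_read e2).
- move=> i; rewrite ffunE by_role_c ffunE /=; apply: tape_at_moveR.
  by have := tape_at_keep (e3 i); rewrite (tape_at_read (e3 i)).
- exact: tape_at_stay.
Qed.

Lemma snapshot_eq st h X Y s c : (forall i, X i =1 Y i) ->
  snapshot st h X s c -> snapshot st h Y s c.
Proof.
move=> E [e1 e2 e3 e4]; split=> // i; exact: tape_at_eq (E i) (e3 i).
Qed.

Definition prev_bits (X : 'I_m -> nat -> cell) (j : nat) : option bits :=
  if j is _.+1 then Some [ffun i => X i j == Some true] else None.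

(** The next sweep, performing [a] on the tapes [X], will show the automaton the digits of [N]. *)
Definition ready (X : 'I_m -> nat -> cell) (a : action) (N : nat) : Prop :=
  (forall i p, (p == 0) || (n.+1 < p) -> X i p = None) /\
  (forall j, j <= n -> next_bits a (prev_bits X j) [ffun i => X i j.+1] = digit_column N j).

Lemma sweep_run ps a X N s c j : ready X a N -> j <= n ->
  snapshot (sweeping ps a None q0) 1 X s c ->
  snapshot (sweeping ps a (prev_bits X j) (run_columns (digit_column N) j)) j.+1
    (fun i p => if 0 < p <= j then Some (digit_column N p.-1 i) else X i p)
    s (iter j (@tm_step _ _ odometer) c).
Proof.
case=> blankX rdy jn snap; elim: j jn => [|j IH] jn.
  by apply: snapshot_eq snap => i [|p].
have := sweep_step jn (IH (ltnW jn)).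
have E : [ffun i : 'I_m => if 0 < j.+1 <= j then Some (digit_column N j.+1.-1 i)
                     else X i j.+1] = [ffun i => X i j.+1].
  by apply/ffunP=> i; rewrite !ffunE ltnn andbF.
rewrite E rdy ?(ltnW jn) // iterS.
have -> : [ffun i : 'I_m => (if 0 < j.+1 <= j then Some (digit_column N j.+1.-1 i)
                     else X i j.+1) == Some true] = [ffun i => X i j.+1 == Some true].
  by apply/ffunP=> i; rewrite !ffunE ltnn andbF.
apply: snapshot_eq => i p; rewrite /write_col /update.
case: eqP => [->|/eqP ne]; first by rewrite /= ltnSn.
by rewrite [p <= j.+1]leq_eqVlt (negbTE ne).
Qed.

Lemma tuple_run ps a X N s c : ready X a N ->
  snapshot (sweeping ps a None q0) 1 X s c ->
  snapshot (after_sweep ps (digit_column N n)) n (fun i => counter_cells (digit B i N))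
    (out_emit s (emit ps (scan N))) (iter n.+1 (@tm_step _ _ odometer) c).
Proof.
move=> rdy snap; have := sweep_last (sweep_run rdy (leqnn n) snap).
have [blankX rdyX] := rdy.
have -> : [ffun i : 'I_m => if 0 < n.+1 <= n then Some (digit_column N n.+1.-1 i)
                     else X i n.+1] = [ffun i => X i n.+1].
  by apply/ffunP=> i; rewrite !ffunE ltnn andbF.
rewrite rdyX // iterS; apply: snapshot_eq => i p; rewrite /write_col /update.
case: eqP => [->|/eqP ne] /=; first by rewrite leqnn ffunE.
case: p ne => [_|p]; first by rewrite /= blankX.
rewrite eqSS /= => ne; rewrite [p <= n]leq_eqVlt (negbTE ne) /=.
by case: ltnP => pn; [rewrite ffunE | rewrite blankX //= ltnS ltn_neqAle eq_sym ne].
Qed.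

Lemma rewind_run ps a N s c h : h <= n.+1 ->
  snapshot (rewinding ps a) h (fun i => counter_cells (digit B i N)) s c ->
  snapshot (sweeping ps a None q0) 1 (fun i => counter_cells (digit B i N)) s
    (iter h.+1 (@tm_step _ _ odometer) c).
Proof.
elim: h c => [|h IH] c hn snap; first exact: rewind_end snap.
rewrite iterSr; apply: IH; first exact: ltnW.
by apply: rewind_step snap => //=; rewrite -ltnS hn.
Qed.

Lemma ready_reset X : (forall i p, (p == 0) || (n.+1 < p) -> X i p = None) ->
  ready X reset_all 0.
Proof.
move=> blankX; split=> // j jn; apply/ffunP=> i; rewrite !ffunE digit0.
by case: j jn.
Qed.

Lemma ready_carry N : ready (fun i => counter_cells (digit B i N))
  (carry (digit_column N n)) N.+1.
Proof.
split=> [i [|p] //= pn|j jn]; first by rewrite leqNgt -ltnS pn.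
apply/ffunP=> i; rewrite !ffunE /= jn.
have maxE (i' : 'I_m) : (n == digit B i' N) = ((digit B i' N).+1 == B).
  by rewrite eqSS eq_sym.
case: ifP => [/forallP up|/negP nup].
  have E : (N %% B ^ i).+1 = B ^ i.
    apply/low_digits_max => // c ci; have ck : c < m := ltn_trans ci (ltn_ord i).
    by have := implyP (up (Ordinal ck)) ci; rewrite ffunE maxE => /eqP.
  rewrite (digit_succ_carry _ E) // -maxE eq_sym.
  case: (eqVneq (digit B i N) n) => [_|ne] /=; first by case: j jn.
  case: j jn => [|j] //= jn.
  by rewrite ffunE (ltnW jn) eqSS; case: (j == _).
rewrite digit_succ_nocarry //; last first.
  apply/eqP=> /low_digits_max E; apply: nup; apply/forallP=> c; apply/implyP=> ci.
  by rewrite ffunE maxE E.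
by case: (j == _).
Qed.

Definition outputs (ps : 'I_3) (N d : nat) : seq bool :=
  pmap (fun N => emit ps (scan N)) (iota N d).

(** Each counter value costs a sweep and a rewind of [n.+1] steps each; the sweep over the largest
    value switches to the next pass. *)
Lemma pass_run ps a X N d s c : N + d.+1 = B ^ m -> ready X a N ->
  snapshot (sweeping ps a None q0) 1 X s c ->
  exists2 t, t <= 2 * B * d.+1 &
    snapshot (if ps == ord_max then finishing ord0 else rewinding (inord ps.+1) reset_all)
      n (fun i => counter_cells (digit B i (B ^ m).-1)) (s ++ outputs ps N d.+1)
      (iter t (@tm_step _ _ odometer) c).
Proof.
elim: d N a X s c => [|d IH] N a X s c Nd rdy snap; have := tuple_run rdy snap.
  have maxN (i : 'I_m) : (digit B i N).+1 = B.
    by apply: (proj2 (@digits_all_max B m N _ _)) => //; rewrite -Nd ?addn1.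
  rewrite /after_sweep ifT; last first.
    by apply/forallP=> i; rewrite ffunE; have := maxN i; case=> ->.
  have -> : (B ^ m).-1 = N by rewrite -Nd addn1.
  move=> h; exists n.+1; first by lia.
  move: h; rewrite /outputs /=.
  by case: (emit ps (scan N)) => [b|] /=; rewrite ?cats1 ?cats0.
rewrite /after_sweep ifF; last first.
  apply/negP=> /forallP up; suff : N.+1 = B ^ m by lia.
  apply/(@digits_all_max B m N) => //; first by lia.
  by move=> i im; have := up (Ordinal im); rewrite ffunE eq_sym => /eqP ->.
move=> /(rewind_run (leqnSn n)); rewrite -iterD => snap'.
have [t le_t h] := IH N.+1 _ _ _ _ (etrans (addSnnS _ _) Nd) (ready_carry N) snap'.
exists (t + (n.+1 + n.+1)); first by nia.
rewrite iterD; move: h; rewrite /outputs /=.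
by case: (emit ps (scan N)) => [b|] //=; rewrite -cats1 -catA.
Qed.

Notation steps t := (iter t (@tm_step _ _ odometer)).

Lemma size_outputs ps N d : size (outputs ps N d) <= d.
Proof. by rewrite size_pmap -[leqRHS](size_iota N) count_size. Qed.

Lemma restart_run ps s c :
  snapshot (rewinding ps reset_all) n (fun i => counter_cells (digit B i (B ^ m).-1)) s c ->
  exists X, ready X reset_all 0 /\ snapshot (sweeping ps reset_all None q0) 1 X s (steps n.+1 c).
Proof.
move=> snap; exists (fun i => counter_cells (digit B i (B ^ m).-1)); split.
  by apply: ready_reset => i [|p] //= pn; rewrite leqNgt -ltnS pn.
exact: rewind_run (leqnSn n) snap.
Qed.

Lemma full_pass ps X s c : ready X reset_all 0 ->
  snapshot (sweeping ps reset_all None q0) 1 X s c ->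
  exists2 t, t <= 2 * B * B ^ m &
    snapshot (if ps == ord_max then finishing ord0 else rewinding (inord ps.+1) reset_all)
      n (fun i => counter_cells (digit B i (B ^ m).-1)) (s ++ outputs ps 0 (B ^ m)) (steps t c).
Proof.
move=> rdy snap; have E : (B ^ m).-1.+1 = B ^ m by rewrite prednK ?expn_gt0.
by have := pass_run (d := (B ^ m).-1) _ rdy snap; rewrite E; apply.
Qed.

Lemma finish_step i s h (c : config odometer) :
  i != ord_max -> cfg_state c = finishing i ->
  tape_at (cfg_tapes c ord_max) h (out_cells s) ->
  let back := (i == ord0) || isSome (out_cells s h) in
  cfg_state (tm_step c) =
    (if i == ord0 then finishing (inord 1)
     else if out_cells s h is Some _ then finishing i else finishing ord_max) /\
  exists t, cfg_tapes (tm_step c) ord_max = tape_move (if back then MoveL else MoveR) t /\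
    tape_at t h (out_cells s).
Proof.
move=> ni e at_t back; have rd := tape_at_read at_t.
rewrite /tm_step e /= (negbTE ni) /trans /react !ffunE rd /back.
have at_w := tape_at_keep at_t; rewrite rd in at_w.
case: (i == ord0) => /=.
  split=> //; exists (tape_write (out_cells s h) (cfg_tapes c ord_max)).
  by rewrite ffunE by_role_out.
case E : (out_cells s h) => [b|] /=; (split=> //;
  exists (tape_write (out_cells s h) (cfg_tapes c ord_max));
  by rewrite ffunE by_role_out /= -E).
Qed.

Lemma finish_run s h (c : config odometer) : h <= size s -> cfg_state c = finishing (inord 1) ->
  tape_at (cfg_tapes c ord_max) h (out_cells s) ->
  cfg_state (steps h.+1 c) = finishing ord_max /\
  tape_at (cfg_tapes (steps h.+1 c) ord_max) 1 (out_cells s).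
Proof.
have n1 : (inord 1 : 'I_3) != ord_max by rewrite -val_eqE /= inordK.
have n0 : ((inord 1 : 'I_3) == ord0) = false by rewrite -val_eqE /= inordK.
elim: h c => [|h IH] c hs e at_t; have [] := finish_step n1 e at_t; rewrite n0 /=.
  by move=> e' [t [-> at']]; split=> //; apply: tape_at_moveR.
have -> : nth None (map Some s) h = Some (nth false s h) by rewrite (nth_map false).
move=> e' [t [E at']]; rewrite -/(iter h.+1 _ _) -iterS iterSr.
by apply: IH => //; [exact: ltnW | rewrite E; apply: tape_at_moveL].
Qed.

Definition total_output : seq bool :=
  outputs ord0 0 (B ^ m) ++ outputs (inord 1) 0 (B ^ m) ++ outputs ord_max 0 (B ^ m).

Lemma odometer_run : exists2 t, t <= 20 * B ^ m.+1 &
  let c := steps t (tm_init odometer w) in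
  halted (cfg_state c) /\ tape_word (cfg_tapes c ord_max) = total_output.
Proof.
have init : snapshot (sweeping ord0 reset_all None q0) 1 (fun _ _ => None) [::]
    (tm_init odometer w).
  split=> //.
  - by rewrite ffunE eqxx map_id; apply: tape_at_start.
  - move=> i; rewrite ffunE ifF; first by split=> [p|[|p]] //=; rewrite nth_nil.
    by apply/eqP=> /(congr1 role); rewrite role_ctape.
  - have -> : cfg_tapes (tm_init odometer w) ord_max = blank_tape bool by rewrite ffunE.
    by split=> [[|p]|[|p]] //=; rewrite !nth_nil.
have rdy0 : ready (fun _ _ => None) reset_all 0 by apply: ready_reset.
have [t0 le0 snap0] := full_pass rdy0 init.
rewrite -val_eqE /= in snap0.
have [X1 [rdy1 snap1]] := restart_run snap0.
have [t2 le2 snap2] := full_pass rdy1 snap1.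
rewrite -val_eqE /= inordK // in snap2.
have [X3 [rdy3 snap3]] := restart_run snap2.
have [t4 le4 snap4] := full_pass rdy3 snap3.
have E2 : inord 2 = ord_max :> 'I_3 by apply: val_inj; rewrite /= inordK.
rewrite E2 eqxx in snap4.
set c4 := iter _ _ _ in snap4; set s := _ ++ _ in snap4.
have sE : s = total_output by rewrite /s /total_output -catA.
have [e4 _ _ at4] := snap4.
have [] := finish_step (i := ord0) isT e4 at4; rewrite eqxx /= => e5 [t [E5 at5]].
have at5' : tape_at (cfg_tapes (tm_step c4) ord_max) (size s) (out_cells s).
  by rewrite E5; apply: tape_at_moveL.
have [e6 at6] := finish_run (leqnn _) e5 at5'.
exists ((size s).+1 + 1 + (t4 + (n.+1 + (t2 + (n.+1 + t0))))).
  have : size s <= 3 * B ^ m.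
    rewrite sE /total_output !size_cat; have := size_outputs ord0 0 (B ^ m).
    have := size_outputs (inord 1) 0 (B ^ m); have := size_outputs ord_max 0 (B ^ m).
    by lia.
  have : 0 < B ^ m by rewrite expn_gt0.
  rewrite [B ^ m.+1]expnS; move: le0 le2 le4; move: (B ^ m) => P; nia.
rewrite !iterD -/c4 [iter 1 _ _]/=; split; first by rewrite e6.
rewrite -sE; apply: nonblank_prefix_eq => p.
by rewrite (proj1 at6 p).
Qed.

End Run.

Lemma odometer_polytime : polytime total_output.
Proof.
exists odometer, (20 * 2 ^ m.+1), m.+1 => w.
have [t le_t [h1 h2]] := odometer_run w.
have stable d (c : config odometer) : halted (cfg_state c) -> iter d (@tm_step _ _ odometer) c = c.
  by move=> h; elim: d => //= d ->; rewrite /tm_step /= h.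
rewrite /tm_outputs_within.
(* For a nonempty input [n.+1 <= 2 * n]; the additive constant of [poly_bound] covers the empty
   one. *)
have le_T : t <= poly_bound (20 * 2 ^ m.+1) m.+1 (size w).
  apply: leq_trans le_t _; rewrite /poly_bound -mulnSr -mulnA leq_mul2l /=.
  case: (posnP (size w)) => [->|w0]; first by rewrite exp1n muln_gt0 !expn_gt0.
  rewrite mulnS; apply: leq_trans (leq_addl _ _).
  by rewrite -expnMn leq_exp2r // mul2n -addnn -addn1 leq_add2l.
rewrite -(subnK le_T) iterD stable //; split=> //.
by rewrite h2 map_id.
Qed.

End Odometer.

(** * Digit information visible to a finite automaton *)

Section Atoms.
Variables (m E : nat).

(* What a finite automaton can learn about digits of a number in base [size w + 1]
   and the letters of [w] at these positions. *)
Record atoms := Atoms {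
  at_eq : {ffun 'I_m * 'I_m -> bool};
  at_succ : {ffun 'I_m * 'I_m -> bool};
  at_const : {ffun 'I_m * 'I_E -> bool};
  at_input : {ffun 'I_m -> option bool};
  at_last : {ffun 'I_m -> bool};
  at_prefix : {ffun 'I_E -> option bool}
}.

Definition atoms_of (w : seq bool) (N : nat) : atoms :=
  let d (c : 'I_m) := digit (size w).+1 c N in {|
  at_eq := [ffun cc : 'I_m * 'I_m => d cc.1 == d cc.2];
  at_succ := [ffun cc : 'I_m * 'I_m => (d cc.1).+1 == d cc.2];
  at_const := [ffun ce : 'I_m * 'I_E => d ce.1 == ce.2];
  at_input := [ffun c => input_at w (d c)];
  at_last := [ffun c => (d c).+1 == size w];
  at_prefix := [ffun e => input_at w (e : 'I_E)]
|}.

Notation bits := {ffun 'I_m -> bool}.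
Notation label := (option bool * bits * 'I_E.+1)%type.
Notation view := ({set label} * {set label * label})%type.

Definition seen (S : {set label}) (P : pred label) : option bool :=
  if [exists x in S, P x && (x.1.1 == Some true)] then Some true
  else if [exists x in S, P x && (x.1.1 == Some false)] then Some false else None.

Definition atoms_of_view (v : view) : atoms := {|
  at_eq := [ffun cc : 'I_m * 'I_m => [exists x in v.1, x.1.2 cc.1 && x.1.2 cc.2]];
  at_succ := [ffun cc : 'I_m * 'I_m => [exists x in v.2, x.1.1.2 cc.1 && x.2.1.2 cc.2]];
  at_const := [ffun ce : 'I_m * 'I_E => [exists x in v.1, x.1.2 ce.1 && (x.2 == ce.2 :> nat)]];
  at_input := [ffun c => seen v.1 (fun x => x.1.2 c)];
  at_last := [ffun c => [exists x in v.2, x.1.1.2 c && (x.2.1.1 == None)]];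
  at_prefix := [ffun e => seen v.1 (fun x => x.2 == (e : 'I_E) :> nat)]
|}.

Definition observer : finType := (view * option label)%type.

(** The automaton collects the columns seen and the pairs of consecutive columns. The position is
    counted only up to [E], so positions below [E] are recognised exactly. *)
Definition observe (q : observer) (x : option bool) (b : bits) : observer :=
  let idx := if q.2 is Some y then minn y.2.+1 E else 0 in
  let y : label := (x, b, inord idx) in
  (y |: q.1.1, if q.2 is Some z then (z, y) |: q.1.2 else q.1.2, Some y).

Definition observer0 : observer := (set0, set0, None).

Section Correct.
Variables (w : seq bool) (N : nat).
Notation n := (size w).
Notation d c := (digit n.+1 (c : 'I_m) N).

Definition column (j : nat) : label :=
  (input_at w j, [ffun c => j == d c], inord (minn j E)).

Fixpoint observed (j : nat) : observer :=
  if j is i.+1 then observe (observed i) (input_at w i) [ffun c => i == d c] else observer0.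

Lemma column_idx j : (column j).2 = minn j E :> nat.
Proof. by rewrite inordK // ltnS geq_minr. Qed.

Lemma observed_prev j : (observed j).2 = if j is i.+1 then Some (column i) else None.
Proof.
elim: j => //= j ->; congr Some; rewrite /column; congr (_, _).
case: j => [|j]; first by rewrite min0n.
by rewrite column_idx; congr inord; lia.
Qed.

Lemma observedP j :
  (forall x, (x \in (observed j).1.1) <-> exists2 i, i < j & x = column i) /\
  (forall x, (x \in (observed j).1.2) <-> exists2 i, i.+1 < j & x = (column i, column i.+1)).
Proof.
elim: j => [|j [IH1 IH2]]; first by split=> x; rewrite inE; split=> // -[].
have last := observed_prev j.+1; rewrite /= /observe /= in last *.
case: last => last; rewrite last; split=> x.
  rewrite in_setU1; split=> [/orP[/eqP->|/IH1[i ij ->]]|[i]]; first by exists j.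
    by exists i; rewrite // ltnW.
  rewrite ltnS leq_eqVlt => /predU1P[-> ->|ij ->]; first by rewrite eqxx.
  by apply/orP; right; apply/IH1; exists i.
rewrite observed_prev; case: j IH2 {IH1 last} => [|j] IH2.
  by rewrite IH2; split=> -[i] //.
rewrite in_setU1; split=> [/orP[/eqP->|/IH2[i ij ->]]|[i]]; first by exists j.
  by exists i; rewrite // ltnW.
rewrite ltnS leq_eqVlt => /predU1P[[->] ->|ij ->]; first by rewrite eqxx.
by apply/orP; right; apply/IH2; exists i.
Qed.

Lemma observed1P j x :
  reflect (exists2 i, i < j & x = column i) (x \in (observed j).1.1).
Proof. by apply: (iffP idP); apply (proj1 (observedP j)). Qed.

Lemma observed2P j x :
  reflect (exists2 i, i.+1 < j & x = (column i, column i.+1)) (x \in (observed j).1.2).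
Proof. by apply: (iffP idP); apply (proj2 (observedP j)). Qed.

Let d_le c : d c < n.+1. Proof. exact: digit_lt. Qed.

Let seen_col (P : pred label) j0 : j0 < n.+1 ->
  (forall j, j < n.+1 -> P (column j) = (j == j0)) ->
  seen (observed n.+1).1.1 P = input_at w j0.
Proof.
move=> j0n hP.
have H b : [exists x in (observed n.+1).1.1, P x && (x.1.1 == Some b)] =
    (input_at w j0 == Some b).
  apply/exists_inP/idP => [[x /observed1P[j jn ->]]|E1].
    by rewrite hP // => /andP[/eqP ->].
  exists (column j0); first by apply/observed1P; exists j0.
  by rewrite hP ?eqxx.
by rewrite /seen !H; case: (input_at w j0) => [[]|].
Qed.

(** Each digit marks exactly one of the [n.+1] columns, so every atom says that a certain column or
    pair of consecutive columns occurs. *)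
Lemma atoms_of_observed : atoms_of_view (observed n.+1).1 = atoms_of w N.
Proof.
have [J JE] : exists J, J = n.+1 by exists n.+1.
have seenJ := seen_col; rewrite -[X in observed X]JE in seenJ *.
have in1 j : j < n.+1 -> column j \in (observed J).1.1.
  by move=> jn; apply/observed1P; exists j; rewrite // JE.
have in2 j : j < n -> (column j, column j.+1) \in (observed J).1.2.
  by move=> jn; apply/observed2P; exists j; rewrite // JE.
rewrite /atoms_of_view /atoms_of; congr Atoms; apply/ffunP.
- case=> a b; rewrite !ffunE /=; apply/exists_inP/eqP => [[x]|E1].
    by case/observed1P => j _ ->; rewrite /= !ffunE => /andP[/eqP <- /eqP <-].
  by exists (column (d a)); rewrite ?in1 //= !ffunE eqxx E1 eqxx.
- case=> a b; rewrite !ffunE /=; apply/exists_inP/eqP => [[x]|E1].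
    by case/observed2P => j _ ->; rewrite /= !ffunE => /andP[/eqP <- /eqP <-].
  exists (column (d a), column (d a).+1); last by rewrite /= !ffunE eqxx E1 eqxx.
  by apply: in2; rewrite -ltnS E1.
- case=> a e; rewrite !ffunE /=; apply/exists_inP/eqP => [[x]|E1].
    case/observed1P => j _ ->; rewrite column_idx /= !ffunE.
    by move=> /andP[/eqP <- /eqP]; have := ltn_ord e; lia.
  exists (column (d a)); rewrite ?in1 // column_idx /= !ffunE eqxx E1.
  by apply/eqP; have := ltn_ord e; lia.
- by move=> c; rewrite !ffunE; apply: seenJ => // j _; rewrite ffunE.
- move=> c; rewrite !ffunE; apply/exists_inP/eqP => [[x]|E1].
    case/observed2P => j jn ->; rewrite /= ffunE => /andP[/eqP <- /eqP].
    move: jn; rewrite JE ltnS leq_eqVlt => /predU1P[-> //|jn].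
    by have [b ->] := input_at_some jn.
  exists (column (d c), column (d c).+1); first by apply: in2; rewrite E1.
  by rewrite /= ffunE eqxx E1 (input_at_none (leqnn _)).
move=> e; rewrite !ffunE; have [en|ne] := ltnP e n.+1.
  apply: seenJ => // j _; rewrite column_idx.
  by apply/eqP/eqP => [|->]; have := ltn_ord e; lia.
rewrite input_at_none ?(ltnW ne) // /seen.
have H b : [exists x in (observed J).1.1, (x.2 == e :> nat) && (x.1.1 == Some b)] = false.
  apply/exists_inP => -[x /observed1P[j jn ->]].
  by rewrite column_idx => /andP[/eqP E1 _]; have := ltn_ord e; lia.
by rewrite !H.
Qed.

End Correct.
End Atoms.

Lemma high_digits0 B r m N : 0 < B -> r <= m -> N < B ^ m ->
  (forall c, r <= c < m -> digit B c N = 0) <-> N < B ^ r.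
Proof.
move=> B0 rm Nm; split=> [h|Nr c /andP[rc cm]]; last first.
  by rewrite /digit divn_small ?mod0n // (leq_trans Nr) // leq_pexp2l.
rewrite -(modn_small Nm); have : forall c, c < m -> r <= c -> digit B c N = 0.
  by move=> c cm rc; apply: h; rewrite rc.
elim: m rm {Nm h} => [|m IH] rm h.
  by move: rm; rewrite leqn0 => /eqP ->; rewrite ltn_mod.
move: rm; rewrite leq_eqVlt => /predU1P[->|rm]; first by rewrite ltn_mod expn_gt0 B0.
rewrite modn_digit // h // add0n; apply: IH => // c cm; apply: h.
exact: ltnW.
Qed.

(** * Writing an adjacency matrix in polynomial time *)

Section Matrix.
Variables (k r E : nat).
Hypotheses (le_rk : r <= k.+1) (E_gt0 : 0 < E).
Notation m := k.+1.

Variable beta : atoms m E -> bool.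

Definition matrix_word (w : seq bool) : seq bool :=
  nseq ((size w).+1 ^ r) true ++ false ::
  [seq beta (atoms_of m E w N) | N <- iota 0 ((size w).+1 ^ m)].

(** The first pass emits [true] when the digits from [r] on vanish, that is for [N < B ^ r]; the
    second emits the separator at [N = 0]; the third emits one matrix entry for every [N]. *)
Lemma matrix_word_polytime : polytime matrix_word.
Proof.
pose e0 : 'I_E := Ordinal E_gt0.
pose high (a : atoms m E) := [forall c : 'I_m, (r <= c) ==> at_const a (c, e0)].
pose zero (a : atoms m E) := [forall c : 'I_m, at_const a (c, e0)].
pose emit (ps : 'I_3) (q : observer m E) : option bool :=
  let a := atoms_of_view q.1 in
  if ps == ord0 then if high a then Some true else None
  else if ps == ord_max then Some (beta a)
  else if zero a then Some false else None.
have [M [c [d H]]] := odometer_polytime (observer0 m E) (@observe m E) emit.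
exists M, c, d => w.
suff <- : total_output (observer0 m E) (@observe m E) emit w = matrix_word w by apply: H.
rewrite /total_output /matrix_word; set B := (size w).+1; have B0 : 0 < B by [].
have aE N : atoms_of_view (scan (observer0 m E) (@observe m E) w N).1 = atoms_of m E w N.
  rewrite -atoms_of_observed; congr (atoms_of_view _.1).
  by rewrite /scan -/B; elim: (B) => //= j ->.
have highE N : N < B ^ m -> high (atoms_of m E w N) = (N < B ^ r).
  move=> Nm; apply/forallP/idP => [h|/(high_digits0 B0 le_rk Nm) h c'].
    apply/(high_digits0 B0 le_rk Nm) => c' /andP[rc cm].
    by have := implyP (h (Ordinal cm)) rc; rewrite ffunE => /eqP.
  by apply/implyP=> rc; rewrite ffunE /= h // rc /=.
have zeroE N : N < B ^ m -> zero (atoms_of m E w N) = (N == 0).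
  move=> Nm; have := @high_digits0 B 0 m N B0 (leq0n _) Nm.
  rewrite expn0 ltnS leqn0 => hz; apply/forallP/idP => [h|/hz h c'].
    by apply/hz => c' /= cm; have := h (Ordinal cm); rewrite ffunE => /eqP.
  by rewrite ffunE /= h // ltn_ord.
have pmap_const (f : nat -> option bool) s o : {in s, forall N, f N = o} ->
    pmap f s = if o is Some b then nseq (size s) b else [::].
  elim: s => [|N s IH] h; first by case: o h.
  have {}IH := IH (fun x xs => h x (mem_behead (s := N :: s) xs)).
  by rewrite /= h ?mem_head // IH; case: o {h IH}.
have i1 : (inord 1 : 'I_3) == ord0 = false by rewrite -val_eqE /= inordK.
have i2 : (inord 1 : 'I_3) == ord_max = false by rewrite -val_eqE /= inordK.
rewrite /outputs -/B -[false :: _]/([:: false] ++ _); congr (_ ++ _).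
  rewrite -(subnKC (leq_pexp2l B0 le_rk)) iotaD pmap_cat add0n.
  rewrite (pmap_const _ _ (Some true)).
    rewrite size_iota (pmap_const _ _ None) ?cats0 // => N; rewrite mem_iota.
    rewrite (subnKC (leq_pexp2l B0 le_rk)) => /andP[rN Nm].
    by rewrite /emit eqxx aE highE // ltnNge rN.
  move=> N; rewrite mem_iota add0n /= => Nr.
  by rewrite /emit eqxx aE highE ?Nr // (leq_trans Nr) // leq_pexp2l.
have Bm : 0 < B ^ m by rewrite expn_gt0 B0.
congr (_ ++ _).
  have emit1 N : N < B ^ m -> emit (inord 1) (scan (observer0 m E) (@observe m E) w N) =
      if N == 0 then Some false else None.
    by move=> Nm; rewrite /emit i1 i2 aE zeroE.
  have -> : iota 0 (B ^ m) = [:: 0] ++ iota 1 (B ^ m).-1 by rewrite -{1}(prednK Bm).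
  rewrite pmap_cat (pmap_const _ _ (Some false)) => [|N].
    rewrite (pmap_const _ _ None) // => N; rewrite mem_iota => /andP[N0 Nm].
    by rewrite emit1 ?gtn_eqF //; move: Nm; rewrite add1n prednK.
  by rewrite inE => /eqP ->; rewrite emit1.
rewrite /emit /= (eq_pmap (f2 := Some \o (fun N => beta (atoms_of m E w N)))).
  by elim: (iota _ _) => //= N s ->.
by move=> N /=; rewrite aE.
Qed.

End Matrix.

(** * Tableaux of verifier runs *)

Section Flags.
Variables (I : finType) (w : seq bool) (P bnd : nat).

(** The verifier's input at [x] as far as [w] determines it: letters, then the separator
    [Some None], then [None] for the certificate region. *)
Definition letter (x : nat) : option (option bool) :=
  if x < size w then Some (input_at w x) else if x == size w then Some None else None.

Definition flag_type : finType :=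
  ({ffun I * I -> bool * bool} * {ffun I -> bool * bool * option (option bool) * bool})%type.

Definition flags (num : I -> nat) : flag_type :=
  ([ffun ij : I * I => (num ij.1 == num ij.2, (num ij.1).+1 == num ij.2)],
   [ffun i => (num i == 0, (num i).+1 == P, letter (num i), bnd <= num i)]).

End Flags.

Section Tableau.
Variable M : tm (option bool) bool.
Notation tapes := 'I_(tm_tapes M).+1.
Notation sym := (tm_sym M).

(* The [p]-th tableau cell of a configuration records, for each tape, the [p]-th
   symbol to the left and the [p]-th symbol to the right of the head. *)
Definition tcell : finType := (tm_state M * {ffun tapes -> option sym * option sym})%type.

(** As cells are indexed relative to the heads, a move shifts a whole tape; hence every cell depends
    on the head cell [origin], and cells 0 and 1 are special. *)
Definition next_cell (first second : bool) (before here after origin : tcell) : tcell :=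
  if tm_halt origin.1 then here else
  let: (q, act) := tm_trans origin.1 [ffun i => (origin.2 i).2] in
  (q, [ffun i => match (act i).2 with
    | MoveN => ((here.2 i).1, if first then (act i).1 else (here.2 i).2)
    | MoveR => (if first then (act i).1 else (before.2 i).1, (after.2 i).2)
    | MoveL => ((after.2 i).1, if first then (here.2 i).1
                               else if second then (act i).1 else (before.2 i).2)
    end]).

Definition cell_of (c : config M) (p : nat) : tcell :=
  (cfg_state c, [ffun i => (nth None (tape_left (cfg_tapes c i)) p,
                            nth None (tape_right (cfg_tapes c i)) p)]).

Lemma cell_of_step c p : cell_of (tm_step c) p =
  next_cell (p == 0) (p == 1) (cell_of c p.-1) (cell_of c p) (cell_of c p.+1) (cell_of c 0).
Proof.
rewrite /next_cell /= /tm_step; case: ifP => // _.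
have -> : [ffun i => ((cell_of c 0).2 i).2] = [ffun i => tape_read (cfg_tapes c i)].
  by apply/ffunP=> i; rewrite !ffunE /= nth0.
case: (tm_trans _ _) => q act; congr (_, _); apply/ffunP=> i; rewrite !ffunE /=.
case: (cfg_tapes c i) => l r; case: (act i) => a [] /=.
- congr pair; first by rewrite nth_behead.
  by case: p => [|[|p]] //=; rewrite ?nth0 ?nth_behead.
- by congr pair; case: p => [|p] //=; rewrite nth_behead.
by congr pair; case: p => [|p] //=; rewrite nth_behead.
Qed.

Notation nums := ('I_5 * bool)%type.
Notation i0 := (@Ordinal 5 0 isT).
Notation i1 := (@Ordinal 5 1 isT).
Notation i2 := (@Ordinal 5 2 isT).
Notation i3 := (@Ordinal 5 3 isT).
Notation i4 := (@Ordinal 5 4 isT).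

(** Where [w] does not fix the symbol, it is a guessed certificate letter or a blank, and a blank
    from the length bound on. *)
Definition start_cell (x : option (option bool)) (beyond : bool) (s : tcell) : bool :=
  [&& s.1 == tm_start M, [forall i, (s.2 i).1 == None],
      [forall i, (i != ord0) ==> ((s.2 i).2 == None)] &
      if x is Some b then (s.2 ord0).2 == Some (tm_in M b)
      else if beyond then (s.2 ord0).2 == None
      else (s.2 ord0).2 \in [:: None; Some (tm_in M (Some true));
                                Some (tm_in M (Some false))]].

(** The parts govern the start row, the end of the guessed certificate, transitions and acceptance.
    In a transition the five cells are left neighbour, cell, right neighbour, head cell and the cell
    one step later; at position 0 the cell replaces its left neighbour. Coordinates enter only
    through flags, which a finite automaton can compute. *)
Definition admissible (fl : flag_type nums) (s : {ffun 'I_5 -> tcell}) : bool :=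
  let eq a b := (fl.1 (a, b)).1 in
  let succ a b := (fl.1 (a, b)).2 in
  let zero a := (fl.2 a).1.1.1 in
  let last a := (fl.2 a).1.1.2 in
  let symbol a := (fl.2 a).1.2 in
  let beyond a := (fl.2 a).2 in
  let t a : nums := (a, false) in
  let p a : nums := (a, true) in
  [&& zero (t i0) ==> start_cell (symbol (p i0)) (beyond (p i0)) (s i0),
      [&& zero (t i0), zero (t i1), succ (p i0) (p i1), symbol (p i0) == None &
          ((s i0).2 ord0).2 == None] ==> (((s i1).2 ord0).2 == None),
      [&& eq (t i0) (t i1), eq (t i1) (t i2), eq (t i2) (t i3), succ (t i1) (t i4),
          eq (p i1) (p i4), succ (p i1) (p i2), zero (p i3) &
          if zero (p i1) then zero (p i0) else succ (p i0) (p i1)] ==>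
       (s i4 == next_cell (zero (p i1)) (zero (p i0) && ~~ zero (p i1))
                          (s i0) (s i1) (s i2) (s i3)) &
      last (t i0) && zero (p i0) ==> (((s i0).2 ord_max).2 == Some (tm_out M true))].

Variables (w : seq bool) (P b : nat).
Notation n := (size w).
Notation bnd := (n.+1 + b).
Hypothesis P_gt0 : 0 < P.

Definition cell_numbers (W : {ffun 'I_5 -> 'I_P * 'I_P}) (ab : nums) : nat :=
  if ab.2 then (W ab.1).2 else (W ab.1).1.

Definition tableau_ok (W : {ffun 'I_5 -> 'I_P * 'I_P}) (s : {ffun 'I_5 -> tcell}) : bool :=
  admissible (flags w P bnd (cell_numbers W)) s.

Variables (V : seq (option bool) -> bool) (T : nat -> nat).
Hypothesis computes : forall z, tm_outputs_within M (T (size z)) z [:: V z].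
Hypothesis bnd_lt : bnd < P.
Hypothesis time_lt : forall y : seq bool, size y <= b -> T (n.+1 + size y) < P.

Notation run y t := (iter t (@tm_step _ _ M) (tm_init M (with_certificate w y))).

Lemma size_with_certificate (y : seq bool) : size (with_certificate w y) = n.+1 + size y.
Proof. by rewrite size_cat /= !size_map addnS. Qed.

Lemma nth_with_certificate (y : seq bool) p :
  nth None (map Some (map (tm_in M) (with_certificate w y))) p =
  match letter w p with
  | Some x => Some (tm_in M x)
  | None => nth None (map (fun c => Some (tm_in M (Some c))) y) (p - n.+1)
  end.
Proof.
rewrite /with_certificate !map_cat /= nth_cat !size_map /letter.
case: ltnP => [pn|np]; first by rewrite -!map_comp /input_at !(nth_map false).
case: eqP => [->|ne]; first by rewrite subnn.
rewrite -[p - n]prednK ?subn_gt0 ?ltn_neqAle ?np ?andbT; last by apply/eqP=> E; rewrite E in ne.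
by rewrite subnS -!map_comp.
Qed.

Lemma run_final y : size y <= b ->
  nth None (tape_right (cfg_tapes (run y P.-1) ord_max)) 0 =
    Some (tm_out M (V (with_certificate w y))).
Proof.
move=> yb; have [h1 h2] := computes (with_certificate w y).
rewrite size_with_certificate in h1 h2.
have le_T : T (n.+1 + size y) <= P.-1 by rewrite -ltnS prednK // time_lt.
have stable d c : tm_halt (cfg_state c) -> iter d (@tm_step _ _ M) c = c.
  by move=> h; elim: d => //= d ->; rewrite /tm_step h.
rewrite -(subnK le_T) iterD stable //; move: h2; rewrite /tape_word /=.
by case: (tape_right _) => [|[a|] r] //= [-> _].
Qed.

Lemma tableau_complete y : size y <= b -> V (with_certificate w y) ->
  exists sigma, solution tableau_ok sigma.
Proof.
move=> yb Vy; exists [ffun c : 'I_P * 'I_P => cell_of (run y c.1) c.2].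
apply/forallP=> W; rewrite /tableau_ok /admissible /= !ffunE /cell_numbers /=.
have init p : cell_of (run y 0) p = (tm_start M,
   [ffun i => (None, if i == ord0 then
       nth None (map Some (map (tm_in M) (with_certificate w y))) p else None)]).
  congr pair; apply/ffunP=> i; rewrite !ffunE /=.
  by case: eqP => _ /=; rewrite nth_nil.
have init0 p : nth None (tape_right (cfg_tapes (run y 0) ord0)) p =
    nth None (map Some (map (tm_in M) (with_certificate w y))) p.
  by have := congr1 (fun s : tcell => (s.2 ord0).2) (init p); rewrite !ffunE.
apply/and4P; split.
- apply/implyP=> /eqP ->; rewrite init; apply/and4P; split=> //=.
  + by apply/forallP=> i; rewrite ffunE.
  + by apply/forallP=> i; apply/implyP=> /negbTE ne; rewrite ffunE ne.
  rewrite ffunE /= nth_with_certificate; case: (letter _ _) => //.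
  case: ifP => [le_p|_].
    rewrite nth_default // size_map; apply: leq_trans yb _.
    by have := leq_sub2r n.+1 le_p; rewrite addKn.
  case: (ltnP ((W i0).2 - n.+1) (size y)) => h; last by rewrite nth_default ?size_map.
  by rewrite (nth_map false) //; case: (nth _ _ _); rewrite !inE eqxx ?orbT.
- apply/implyP=> /and5P[/eqP -> /eqP -> /eqP <- /eqP letn]; rewrite !init0 !nth_with_certificate letn.
  have np : n < (W i0).2 by move: letn; rewrite /letter; case: ltngtP.
  rewrite /letter ltnNge (leqW (ltnW np)) /= gtn_eqF ?ltnS ?(ltnW np) //.
  move=> /eqP h; apply/eqP; rewrite nth_default // size_map.
  case: (ltnP ((W i0).2 - n.+1) (size y)) => h1; last by apply: leq_trans h1 (leq_sub2r _ (leqnSn _)).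
  by move: h; rewrite (nth_map false).
- apply/implyP=> /and5P[/eqP e01 /eqP e12 /eqP e23 /eqP e14].
  case/and4P=> /eqP q14 /eqP q12 /eqP q3 pre.
  rewrite -e14 -q14 -q12 q3 -e23 -e12 e01 iterS cell_of_step; apply/eqP.
  move: pre; case: (nat_of_ord (W i1).2) => [|x] /=; first by move=> /eqP ->.
  by rewrite eqSS => /eqP ->; rewrite andbT.
apply/implyP=> /andP[/eqP eP /eqP ->].
have -> : (W i0).1 = P.-1 :> nat by apply: succn_inj; rewrite prednK // eP.
by rewrite run_final // Vy.
Qed.

Section Sound.
Variable sigma : {ffun 'I_P * 'I_P -> tcell}.
Hypothesis sol : solution tableau_ok sigma.

Let cell t p := sigma (modl P_gt0 t, modl P_gt0 p).

Let sol_at (t p : 'I_5 -> nat) : (forall a, t a < P) -> (forall a, p a < P) ->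
  admissible (flags w P bnd (fun ab : nums => if ab.2 then p ab.1 else t ab.1))
    [ffun a => cell (t a) (p a)].
Proof.
move=> tP pP; have := forallP sol [ffun a => (modl P_gt0 (t a), modl P_gt0 (p a))].
rewrite /tableau_ok; congr admissible; last by apply/ffunP=> a; rewrite !ffunE.
have E ab : cell_numbers [ffun a => (modl P_gt0 (t a), modl P_gt0 (p a))] ab =
    (fun ab : nums => if ab.2 then p ab.1 else t ab.1) ab.
  by case: ab => a [] /=; rewrite /cell_numbers ffunE /= modn_small.
by congr pair; apply/ffunP=> i; rewrite !ffunE !E.
Qed.

Let pick5 (x0 x1 x2 x3 x4 : nat) (a : 'I_5) := nth 0 [:: x0; x1; x2; x3; x4] a.

Let pick5_lt x0 x1 x2 x3 x4 : [&& x0 < P, x1 < P, x2 < P, x3 < P & x4 < P] ->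
  forall a, pick5 x0 x1 x2 x3 x4 a < P.
Proof. by case/and5P=> ? ? ? ? ? [[|[|[|[|[|]]]]]]. Qed.

Lemma sol_start p : p < P -> start_cell (letter w p) (bnd <= p) (cell 0 p).
Proof.
move=> pP; have h := sol_at (@pick5_lt 0 0 0 0 0 _) (@pick5_lt p p p p p _).
by move: h; rewrite pP P_gt0 => /(_ isT isT) /and4P[+ _ _ _]; rewrite !ffunE.
Qed.

Lemma sol_blank p : p.+1 < P -> letter w p = None ->
  ((cell 0 p).2 ord0).2 = None -> ((cell 0 p.+1).2 ord0).2 = None.
Proof.
move=> pP lp cp; have pP' := ltnW pP.
have h := sol_at (@pick5_lt 0 0 0 0 0 _) (@pick5_lt p p.+1 p p p _).
move: h; rewrite pP pP' P_gt0 => /(_ isT isT) /and4P[_ + _ _].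
by rewrite !ffunE /= /pick5 /= lp cp !eqxx /= => /eqP.
Qed.

(* Nothing constrains the cells at the right border, and errors spread by one cell
   per step; hence the cells with [t + p < P] are correct. *)
Lemma sol_step t p : t.+1 < P -> p.+1 < P -> cell t.+1 p =
  next_cell (p == 0) (p == 1) (cell t p.-1) (cell t p) (cell t p.+1) (cell t 0).
Proof.
move=> tP pP; have pP' := ltnW pP; have tP' := ltnW tP.
have h := sol_at (@pick5_lt t t t t t.+1 _) (@pick5_lt p.-1 p p.+1 0 p _).
have pP'' : p.-1 < P := leq_ltn_trans (leq_pred p) pP'.
move: h; rewrite tP tP' pP pP' pP'' P_gt0 => /(_ isT isT) /and4P[_ _ + _].
rewrite !ffunE /= /pick5 /= !eqxx /=; case: p {pP pP' pP''} => [|p] /=.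
  by move=> /eqP.
by rewrite !eqxx /= => /eqP ->; rewrite andbT.
Qed.

Lemma sol_accept : ((cell P.-1 0).2 ord_max).2 = Some (tm_out M true).
Proof.
have h := sol_at (@pick5_lt P.-1 P.-1 P.-1 P.-1 P.-1 _) (@pick5_lt 0 0 0 0 0 _).
have PP : P.-1 < P by rewrite prednK.
move: h; rewrite PP P_gt0 => /(_ isT isT) /and4P[_ _ _ +].
by rewrite !ffunE /= /pick5 /= prednK // !eqxx /= => /eqP.
Qed.

Lemma row_word (S : eqType) (h : bool -> S) (g : nat -> option S) len m :
  (forall i, i < len -> g i \in [:: None; Some (h true); Some (h false)]) ->
  (forall i, i.+1 < len -> g i = None -> g i.+1 = None) ->
  (forall i, m <= i < len -> g i = None) ->
  exists2 y : seq bool, size y <= m &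
    forall i, i < len -> g i = nth None (map (fun c => Some (h c)) y) i.
Proof.
elim: m g len => [|m IH] g len vals mono fin.
  by exists [::] => // i il; rewrite nth_nil fin.
case: (posnP len) => [->|len0]; first by exists [::].
have [y ym yE] := IH (fun i => g i.+1) len.-1
  (fun i il => vals i.+1 (etrans (esym (ltn_predRL i len)) il))
  (fun i il => mono i.+1 (etrans (esym (ltn_predRL i.+1 len)) il))
  (fun i hi => fin i.+1 ltac:(by move: hi; rewrite -ltn_predRL ltnS)).
have all_none : g 0 = None -> forall i, i < len -> g i = None.
  by move=> g0; elim=> [|i IHi] // il; apply: mono => //; apply: IHi; apply: ltnW.
have := vals 0 len0; rewrite !inE => /or3P[] /eqP g0.
- by exists [::] => // i il; rewrite nth_nil all_none.
- exists (true :: y) => // -[|i] il //=; rewrite -yE // -ltnS prednK //.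
exists (false :: y) => // -[|i] il //=; rewrite -yE // -ltnS prednK //.
Qed.

Lemma tableau_sound : exists2 y : seq bool, size y <= b & V (with_certificate w y).
Proof.
have letter_big i : letter w (n.+1 + i) = None.
  have h : n < n.+1 + i by rewrite addSn ltnS leq_addr.
  by rewrite /letter ltnNge (ltnW h) gtn_eqF.
have [] := @row_word _ (fun c => tm_in M (Some c))
  (fun i => ((cell 0 (n.+1 + i)).2 ord0).2) (P - n.+1) b.
- move=> i il; have iP : n.+1 + i < P by lia.
  have /and4P[_ _ _] := sol_start iP; rewrite letter_big.
  by case: ifP => // _ /eqP ->; rewrite inE eqxx.
- move=> i il; rewrite addnS; apply: sol_blank; last exact: letter_big.
  by lia.
- move=> i /andP[bi il]; have iP : n.+1 + i < P by lia.
  have /and4P[_ _ _] := sol_start iP; rewrite letter_big leq_add2l bi.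
  by move=> /eqP.
move=> y yb yE; exists y => //.
have start p : p < P -> cell 0 p = cell_of (run y 0) p.
  move=> pP; have /and4P[/eqP e1 /forallP e2 /forallP e3 e4] := sol_start pP.
  rewrite (surjective_pairing (cell 0 p)) e1; congr pair; apply/ffunP=> i.
  rewrite [RHS]ffunE [LHS]surjective_pairing (eqP (e2 i)).
  have -> : cfg_tapes (run y 0) i = if i == ord0
      then input_tape (map (@tm_in _ _ M) (with_certificate w y)) else blank_tape sym.
    by rewrite ffunE.
  case: eqP => [->|/eqP ne] /=; rewrite nth_nil; congr pair; last first.
    by apply/eqP; apply: (implyP (e3 i)).
  rewrite nth_with_certificate; case E: (letter w p) e4 => [x|] /=; first by move/eqP.
  move=> _; have np : n.+1 <= p by move: E; rewrite /letter; case: ltngtP.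
  by rewrite -yE ?subnKC // ltn_sub2r // (leq_ltn_trans np).
have cone t p : t + p < P -> cell t p = cell_of (run y t) p.
  elim: t p => [|t IH] p tp; first exact: start.
  rewrite sol_step; [|lia|lia].
  by rewrite iterS cell_of_step !IH //; lia.
(* The accepting cell has time [P.-1] and position 0, just inside the cone. *)
have := sol_accept; rewrite cone ?addn0 ?prednK // !ffunE /= run_final //.
by move=> -[] /(@tm_out_inj _ _ M) ->.
Qed.

End Sound.

End Tableau.

(** * Arithmetic on digits *)

Section Digits.
Variable B : nat.
Hypothesis B_gt0 : 0 < B.

Definition of_digits (D : nat) (e : nat -> nat) : nat := \sum_(j < D) e j * B ^ j.

Lemma of_digits_lt D e : (forall j, j < D -> e j < B) -> of_digits D e < B ^ D.
Proof.
elim: D => [|D IH] eB; first by rewrite /of_digits big_ord0.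
have := IH (fun j jD => eB j (ltnW jD)); have := eB D (ltnSn D).
by rewrite /of_digits big_ord_recr expnS /=; nia.
Qed.

Lemma digit_addM r c x y : c < r -> digit B c (x * B ^ r + y) = digit B c y.
Proof.
move=> cr; have -> : x * B ^ r = x * B ^ (r - c.+1) * B * B ^ c.
  by rewrite -!mulnA -expnS -expnD subnK.
by rewrite /digit divnMDl ?expn_gt0 ?B_gt0 // modnMDl.
Qed.

Lemma digit_of_digits D e j : (forall j, j < D -> e j < B) -> j < D ->
  digit B j (of_digits D e) = e j.
Proof.
elim: D => // D IH eB; have eB' i (iD : i < D) := eB i (ltnW iD).
have lt := of_digits_lt eB'; have eD := eB D (ltnSn D).
rewrite /of_digits big_ord_recr -/(of_digits D e) /= ltnS leq_eqVlt => /predU1P[->|jD].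
  by rewrite /digit addnC divnMDl ?expn_gt0 ?B_gt0 // divn_small // addn0 modn_small.
by rewrite addnC digit_addM // IH.
Qed.

Lemma of_digitsK D x : x < B ^ D -> of_digits D (fun j => digit B j x) = x.
Proof.
move=> xD; rewrite -[RHS](modn_small xD) {xD}.
elim: D => [|D IH]; first by rewrite /of_digits big_ord0 modn1.
by rewrite /of_digits big_ord_recr modn_digit // -IH addnC.
Qed.

Lemma eq_of_digits D e e' : (forall j, j < D -> e j = e' j) -> of_digits D e = of_digits D e'.
Proof. by move=> E; apply: eq_bigr => j _; rewrite E. Qed.

Lemma of_digits_inj D e e' : (forall j, j < D -> e j < B) -> (forall j, j < D -> e' j < B) ->
  (of_digits D e == of_digits D e') = [forall j : 'I_D, e j == e' j].
Proof.
move=> eB eB'; apply/eqP/forallP => [E j|E].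
  by rewrite -(digit_of_digits eB (ltn_ord j)) E digit_of_digits.
by apply: eq_of_digits => j jD; apply/eqP; apply: (E (Ordinal jD)).
Qed.

Fixpoint digits_ltb (D : nat) (e e' : nat -> nat) : bool :=
  if D is c.+1 then (e c < e' c) || (e c == e' c) && digits_ltb c e e' else false.

Lemma digits_lt D x y : x < B ^ D -> y < B ^ D ->
  (x < y) = digits_ltb D (digit B ^~ x) (digit B ^~ y).
Proof.
move=> xD yD; rewrite -{1}(modn_small xD) -{1}(modn_small yD) {xD yD}.
elim: D => [|D IH]; first by rewrite !modn1.
rewrite /= -IH !modn_digit //; have Bc : 0 < B ^ D by rewrite expn_gt0 B_gt0.
have := ltn_pmod x Bc; have := ltn_pmod y Bc.
move: (B ^ D) (digit B D y) (digit B D x) (y %% _) (x %% _) Bc => C q p b a C0 bC aC.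
case: (ltngtP p q) => h /=; [|apply/negbTE; rewrite -leqNgt|by rewrite h ltn_add2l].
  have : p.+1 * C <= q * C by rewrite leq_mul2r h orbT.
  by rewrite mulSn; lia.
have : q.+1 * C <= p * C by rewrite leq_mul2r h orbT.
by rewrite mulSn; lia.
Qed.

Lemma digits_succ D x y : x < B ^ D -> y < B ^ D -> (x.+1 == y) =
  ~~ [forall j : 'I_D, (digit B j x).+1 == B] &&
  [forall j : 'I_D, if [forall i : 'I_D, (i < j) ==> ((digit B i x).+1 == B)]
     then (if (digit B j x).+1 == B then digit B j y == 0
           else (digit B j x).+1 == digit B j y)
     else digit B j x == digit B j y].
Proof.
move=> xD yD.
have [full|notfull] := boolP [forall j : 'I_D, (digit B j x).+1 == B].
  have /(digits_all_max B_gt0 xD) E : forall i, i < D -> (digit B i x).+1 = B.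
    by move=> i iD; apply/eqP; apply: (forallP full (Ordinal iD)).
  by rewrite E gtn_eqF.
have xD' : x.+1 < B ^ D.
  rewrite ltn_neqAle xD andbT; apply: contra notfull => /eqP E.
  by apply/forallP=> j; apply/eqP; apply: (proj2 (digits_all_max B_gt0 xD)).
rewrite /= -{1}(of_digitsK xD') -{1}(of_digitsK yD) of_digits_inj //; first last.
- by move=> j _; apply: digit_lt.
- by move=> j _; apply: digit_lt.
apply: eq_forallb => j; case: ifP => [/forallP low|/negP nlow].
  have E : (x %% B ^ j).+1 = B ^ j.
    apply/low_digits_max => // i ij.
    by apply/eqP; apply: (implyP (low (Ordinal (ltn_trans ij (ltn_ord j)))) ij).
  by rewrite (digit_succ_carry B_gt0 E); case: ifP => _; rewrite // eq_sym.
rewrite digit_succ_nocarry //; apply/eqP=> /low_digits_max low; apply: nlow.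
by apply/forallP=> i; apply/implyP=> ij; apply/eqP; apply: low.
Qed.

End Digits.

Lemma digit_pair B r c x y : 0 < B -> c < r -> y < B ^ r ->
  digit B c (y + x * B ^ r) = digit B c y.
Proof.
by move=> B0 cr yr; rewrite addnC digit_addM.
Qed.

Lemma digit_pair_high B r c x y : 0 < B -> y < B ^ r ->
  digit B (r + c) (y + x * B ^ r) = digit B c x.
Proof.
move=> B0 yr; have Br : 0 < B ^ r by rewrite expn_gt0 B0.
by rewrite /digit expnD divnMA addnC divnMDl // [y %/ _]divn_small // addn0.
Qed.

Lemma encode_ord_graph (M : nat) (e : nat -> nat -> bool)
    (e_sym : symmetric (fun x y : 'I_M => e x y)) :
  encode_graph (Graph e_sym) =
  nseq M true ++ false :: [seq e (N %/ M) (N %% M) | N <- iota 0 (M * M)].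
Proof.
rewrite /encode_graph /= card_ord; congr (_ ++ _ :: _).
transitivity [seq e x y | x <- iota 0 M, y <- iota 0 M].
  by rewrite -val_enum_ord allpairs_mapl; congr flatten; apply: eq_map => x;
    rewrite -map_comp.
case: (posnP M) => [->|M0] //.
suff H k : [seq e x y | x <- iota 0 k, y <- iota 0 M] =
    [seq e (N %/ M) (N %% M) | N <- iota 0 (k * M)] by apply: H.
elim: k => // k IH; rewrite -addn1 iotaD allpairs_cat IH mulnDl mul1n iotaD map_cat.
congr (_ ++ _); rewrite /= cats0 !add0n -[k * M in RHS]addn0 iotaDl -map_comp.
apply/eq_in_map => y; rewrite mem_iota => /= yM.
by rewrite divnMDl // divn_small // addn0 modnMDl modn_small.
Qed.

(** * Tableau coordinates of two vertices, read from digits *)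

Section VertexPair.
Variables (K D E c0 d0 : nat).
Notation r' := (K * 2 * D).
Notation r := r'.+1.
Notation m := (r' + r).+1.
Notation slot := (bool * 'I_K * bool)%type.

(** A vertex number has [D] digits for each of the time and the position of its [K] cells; its last
    digit, at [r'], is left for the code. *)
Definition number_index (i : nat) (tp : bool) (j : nat) : nat := (i * 2 + tp) * D + j.

Lemma number_index_lt i (tp : bool) j : i < K -> j < D -> number_index i tp j < r'.
Proof.
rewrite /number_index => iK jD.
have : (i * 2 + tp).+1 * D <= r' by rewrite leq_mul2r; case: tp; lia.
by rewrite mulSn; lia.
Qed.

Definition atom_index (X : slot) (j : nat) : 'I_m :=
  inord ((if X.1.1 then r else 0) + number_index X.1.2 X.2 j).

(* The digits in base [n] of [n.+1 + poly_bound c0 d0 n], for large [n]. *)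
Definition bound_digit (j : nat) : nat :=
  (j == 0) * c0.+1 + (j == 1) + (j == d0) * c0.

Section Formula.
Variable a : atoms m E.

Definition atom_const (c : 'I_m) (k : nat) : bool :=
  [exists e : 'I_E, (e == k :> nat) && at_const a (c, e)].

Definition atom_ltb (c : 'I_m) (k : nat) : bool :=
  [exists e : 'I_E, (e < k) && at_const a (c, e)].

Definition slot_eq (X Y : slot) : bool :=
  [forall j : 'I_D, at_eq a (atom_index X j, atom_index Y j)].

Definition slot_last (X : slot) : bool := [forall j : 'I_D, at_last a (atom_index X j)].

Definition slot_succ (X Y : slot) : bool :=
  ~~ slot_last X &&
  [forall j : 'I_D, if [forall i : 'I_D, (i < j) ==> at_last a (atom_index X i)]
     then (if at_last a (atom_index X j) then atom_const (atom_index Y j) 0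
           else at_succ a (atom_index X j, atom_index Y j))
     else at_eq a (atom_index X j, atom_index Y j)].

Definition slot_is (X : slot) (e : nat -> nat) : bool :=
  [forall j : 'I_D, atom_const (atom_index X j) (e j)].

(** A number is below [n] if all digits but the lowest vanish, and then the lowest digit points at
    its letter. The number [n] itself has digit 1 at place 1 and 0 elsewhere. *)
Definition slot_letter (X : slot) : option (option bool) :=
  if [forall j : 'I_D, (0 < j) ==> atom_const (atom_index X j) 0]
  then Some (at_input a (atom_index X 0))
  else if slot_is X (fun j => j == 1) then Some None else None.

Fixpoint slot_ltb (X : slot) (j : nat) : bool :=
  if j is i.+1 then atom_ltb (atom_index X i) (bound_digit i) ||
      atom_const (atom_index X i) (bound_digit i) && slot_ltb X i
  else false.

Definition slot_flags : flag_type slot :=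
  ([ffun XY : slot * slot => (slot_eq XY.1 XY.2, slot_succ XY.1 XY.2)],
   [ffun X => (slot_is X (fun=> 0), slot_last X, slot_letter X, ~~ slot_ltb X D)]).

End Formula.

Variables (w : seq bool) (u v : nat).
Notation n := (size w).
Notation B := n.+1.

Definition vertex_number (v : nat) (i : 'I_K) (tp : bool) : nat :=
  of_digits n D (fun j => digit B (number_index i tp j) v).

Hypotheses (D_gt1 : 1 < D) (d0D : d0 < D) (big_n : (2 * c0).+2 < n) (big_E : (2 * c0).+2 < E).
Hypotheses (u_lt : u < B ^ r) (v_lt : v < B ^ r).
Hypotheses (u_ok : forall c, c < r' -> digit B c u < n)
           (v_ok : forall c, c < r' -> digit B c v < n).

Let N := v + u * B ^ r.
Let a := atoms_of m E w N.
Let side (X : slot) := if X.1.1 then u else v.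
Let dg (X : slot) (j : nat) := digit B (number_index X.1.2 X.2 j) (side X).
Let num (X : slot) := vertex_number (side X) X.1.2 X.2.
Let n_gt0 : 0 < n. Proof. by apply: leq_ltn_trans big_n. Qed.

Let atom_indexE X j : j < D -> digit B (atom_index X j) N = dg X j.
Proof.
move=> jD; have ij := number_index_lt X.2 (ltn_ord X.1.2) jD.
rewrite /atom_index inordK; last by case: ifP => _; lia.
rewrite /dg /side; case: ifP => _; first by rewrite digit_pair_high.
by rewrite add0n digit_pair // ltnW.
Qed.

Let dg_lt X j : j < D -> dg X j < n.
Proof.
move=> jD; have ij := number_index_lt X.2 (ltn_ord X.1.2) jD.
by rewrite /dg /side; case: ifP => _; [apply: u_ok | apply: v_ok].
Qed.

Let num_lt X : num X < n ^ D.
Proof. by apply: of_digits_lt => // j; apply: dg_lt. Qed.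

Let digit_num X j : j < D -> digit n j (num X) = dg X j.
Proof. by move=> jD; rewrite digit_of_digits // => i; apply: dg_lt. Qed.

Let at_constE X j k : j < D -> k < E -> atom_const a (atom_index X j) k = (dg X j == k).
Proof.
move=> jD kE; apply/existsP/eqP => [[e /andP[/eqP <-]]|E1].
  by rewrite ffunE atom_indexE // => /eqP.
by exists (Ordinal kE); rewrite ffunE atom_indexE //= E1 eqxx.
Qed.

Let at_ltbE X j k : j < D -> k <= E -> atom_ltb a (atom_index X j) k = (dg X j < k).
Proof.
move=> jD kE; apply/existsP/idP => [[e /andP[ek]]|lt].
  by rewrite ffunE atom_indexE // => /eqP ->.
by exists (Ordinal (leq_trans lt kE)); rewrite ffunE atom_indexE //= lt eqxx.
Qed.

Let at_lastE X j : j < D -> at_last a (atom_index X j) = ((dg X j).+1 == n).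
Proof. by move=> jD; rewrite ffunE atom_indexE. Qed.

Lemma sum_digit_single k j0 : j0 < D -> \sum_(j < D) (j == j0 :> nat) * k * n ^ j = k * n ^ j0.
Proof.
move=> jD; rewrite (bigD1 (Ordinal jD)) //= eqxx mul1n big1 ?addn0 // => j.
by rewrite -val_eqE /= => /negbTE ->.
Qed.

Lemma bound_digitsE : of_digits n D bound_digit = n.+1 + poly_bound c0 d0 n.
Proof.
rewrite /of_digits (eq_bigr (fun j : 'I_D => (j == 0 :> nat) * c0.+1 * n ^ j +
  (j == 1 :> nat) * 1 * n ^ j + (j == d0 :> nat) * c0 * n ^ j)); last first.
  by move=> j _; rewrite /bound_digit !mulnDl muln1.
rewrite !big_split /= !sum_digit_single //; last exact: ltnW.
by rewrite /poly_bound expn0 expn1; lia.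
Qed.

Lemma bound_digit_le j : bound_digit j <= (2 * c0).+2.
Proof. by rewrite /bound_digit; do !case: eqP => _ /=; lia. Qed.

(** Everything a constraint may ask about the tableau coordinates is a fixed function of the atoms,
    uniformly in [w]. *)
Lemma slot_flagsE : flags w (n ^ D) (n.+1 + poly_bound c0 d0 n) num = slot_flags a.
Proof.
have bd_lt j : bound_digit j < n := leq_ltn_trans (bound_digit_le j) big_n.
have bd_E j : bound_digit j < E := leq_ltn_trans (bound_digit_le j) big_E.
have E0 : 0 < E := leq_ltn_trans (leq0n _) big_E.
have dgn Z j : j < D -> dg Z j < n by apply: dg_lt.
have isE X e : (forall j, e j < n) -> (forall j, e j < E) ->
    slot_is a X e = (num X == of_digits n D e).
  move=> en eE; rewrite (of_digits_inj n_gt0); last by move=> j _; apply: en.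
    by apply: eq_forallb => j; rewrite at_constE.
  by move=> j; apply: dgn.
have lastE Z : slot_last a Z = [forall j : 'I_D, (digit n j (num Z)).+1 == n].
  by apply: eq_forallb => j; rewrite at_lastE // digit_num.
congr pair; apply/ffunP.
  case=> X Y; rewrite !ffunE /=; congr pair.
    rewrite (of_digits_inj n_gt0); try by move=> j; apply: dgn.
    by apply: eq_forallb => j; rewrite ffunE !atom_indexE.
  rewrite (digits_succ n_gt0 (num_lt X) (num_lt Y)) /slot_succ lastE; congr (_ && _).
  apply: eq_forallb => j; rewrite !digit_num // at_lastE //.
  rewrite at_constE // !ffunE !atom_indexE //.
  congr (if _ then _ else _); apply: eq_forallb => i.
  by rewrite at_lastE // digit_num.
move=> X; rewrite !ffunE; congr (_, _, _, _).
- rewrite isE //; congr (_ == _).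
  by rewrite /of_digits big1.
- rewrite lastE; apply/eqP/forallP => [/(digits_all_max n_gt0 (num_lt X)) h j|h].
    by apply/eqP/h.
  by apply/(digits_all_max n_gt0 (num_lt X)) => j jD; apply/eqP/(h (Ordinal jD)).
- rewrite /slot_letter; have n1 : 1 < n by lia.
  have E1 : 1 < E by lia.
  have D0 : 0 < D by lia.
  have -> : [forall j : 'I_D, (0 < j) ==> atom_const a (atom_index X j) 0] = (num X < n).
    apply/forallP/idP => [h|lt j].
      have := @high_digits0 n 1 D (num X) n_gt0 D0 (num_lt X); rewrite expn1.
      case=> + _; apply=> j /andP[j1 jD].
      by have := implyP (h (Ordinal jD)) j1; rewrite at_constE // digit_num // => /eqP.
    apply/implyP=> j0; rewrite at_constE // -digit_num //.
    by rewrite /digit divn_small ?mod0n // (leq_trans lt) // -{1}(expn1 n) leq_pexp2l.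
  rewrite /letter; case: ltnP => [lt|_].
    rewrite ffunE atom_indexE // -digit_num // /digit expn0 divn1 modn_small //.
  rewrite isE //; try by move=> j; case: eqP => _ /=; lia.
  congr (if num X == _ then _ else _); rewrite /of_digits.
  by rewrite -[LHS]mul1n -{1}(expn1 n) -sum_digit_single //; apply: eq_bigr => j _; rewrite muln1.
rewrite leqNgt -bound_digitsE (digits_lt n_gt0 (num_lt X)) ?of_digits_lt //.
congr (~~ _).
suff H i : i <= D -> digits_ltb i (digit n ^~ (num X)) (digit n ^~ (of_digits n D bound_digit))
    = slot_ltb a X i by apply: H.
elim: i => //= i IH iD; rewrite digit_num // digit_of_digits // at_ltbE ?(ltnW (bd_E i)) //.
by rewrite at_constE // IH // ltnW.
Qed.

End VertexPair.

(** * The reduction *)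

Lemma eq_flags_comp (I J : finType) w1 P1 b1 (num1 : J -> nat) w2 P2 b2 (num2 : J -> nat)
    (h : I -> J) : flags w1 P1 b1 num1 = flags w2 P2 b2 num2 ->
  flags w1 P1 b1 (num1 \o h) = flags w2 P2 b2 (num2 \o h).
Proof.
move=> [/ffunP e1 /ffunP e2]; congr pair; apply/ffunP.
  by case=> i j; have := e1 (h i, h j); rewrite !ffunE.
by move=> i; have := e2 (h i); rewrite !ffunE.
Qed.

Lemma eq_flags (I : finType) w P b (num num' : I -> nat) : num =1 num' ->
  flags w P b num = flags w P b num'.
Proof. by move=> E; congr pair; apply/ffunP => i; rewrite !ffunE !E. Qed.

(** * Instances with equal flags have equal gadget edges *)

Section Transfer.
Variables (l K : nat) (M : tm (option bool) bool).
Notation assignment := {ffun 'I_K -> tcell M}.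
Notation code := {ffun assignment -> 'I_l}.
Notation slot := (bool * 'I_K * bool)%type.

Definition scope_number P (U U' : {ffun 'I_K -> 'I_P * 'I_P}) (X : slot) : nat :=
  let c := (if X.1.1 then U else U') X.1.2 in if X.2 then c.2 else c.1.

Section TwoInstances.
Variables (w1 w2 : seq bool) (P1 P2 b1 b2 : nat).
Variables (U1 V1 : {ffun 'I_K -> 'I_P1 * 'I_P1}) (U2 V2 : {ffun 'I_K -> 'I_P2 * 'I_P2}).
Hypothesis same_flags :
  flags w1 P1 ((size w1).+1 + b1) (scope_number U1 V1) =
  flags w2 P2 ((size w2).+1 + b2) (scope_number U2 V2).

Lemma same_number_eq X Y : (scope_number U1 V1 X == scope_number U1 V1 Y) =
  (scope_number U2 V2 X == scope_number U2 V2 Y).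
Proof. by have [/ffunP/(_ (X, Y)) + _] := same_flags; rewrite !ffunE => -[]. Qed.

Lemma same_cell_eq (s s' : bool) i j :
  ((if s then U1 else V1) i == (if s' then U1 else V1) j) =
  ((if s then U2 else V2) i == (if s' then U2 else V2) j).
Proof.
have H tp := same_number_eq (s, i, tp) (s', j, tp).
have h1 := H false; have h2 := H true; move: h1 h2; rewrite /scope_number /= => h1 h2.
rewrite [LHS](_ : _ = (((if s then U1 else V1) i).1 == ((if s' then U1 else V1) j).1 :> nat) &&
  (((if s then U1 else V1) i).2 == ((if s' then U1 else V1) j).2 :> nat)) //.
by rewrite h1 h2.
Qed.

Lemma same_good (s : bool) (asg : assignment) :
  good (tableau_ok w1 b1) (if s then U1 else V1) asg =
  good (tableau_ok w2 b2) (if s then U2 else V2) asg.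
Proof.
congr andb.
  by apply: eq_forallb => i; apply: eq_forallb => j; rewrite same_cell_eq.
apply: eq_forallb => q; rewrite /tableau_ok; congr admissible.
pose h (ab : 'I_5 * bool) : slot := (s, q ab.1, ab.2).
rewrite (@eq_flags _ _ _ _ _ (scope_number U1 V1 \o h)).
  rewrite (eq_flags_comp h same_flags); apply: eq_flags => ab.
  by rewrite /cell_numbers /scope_number /= ffunE.
by move=> ab; rewrite /cell_numbers /scope_number /= ffunE.
Qed.

Lemma same_gadget_edge (x y : code) :
  gadget_edge (tableau_ok w1 b1) (U1, x) (V1, y) =
  gadget_edge (tableau_ok w2 b2) (U2, x) (V2, y).
Proof.
apply: eq_forallb => s; apply: eq_forallb => s' /=.
rewrite (same_good true s) (same_good false s').
congr ([&& _, _ & _] ==> _); apply: eq_forallb => i; apply: eq_forallb => j.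
by rewrite (same_cell_eq true false).
Qed.

End TwoInstances.
End Transfer.

(** Input, separator and certificate have length at most [n ^ d0.+2], so the time is at most
    [2 * c1 * n ^ (d0.+2 * d1)], and one more factor [n] absorbs [2 * c1]. The summand [d0.+3] of
    [D] serves the first bound. *)
Lemma poly_dominated c0 d0 c1 d1 :
  let D := (d0.+2 * d1).+1 + d0.+3 in
  let n0 := 2 * c0 + 2 * c1 + 10 in
  forall n, n0 <= n ->
    n.+1 + poly_bound c0 d0 n < n ^ D /\
    forall s, s <= poly_bound c0 d0 n -> poly_bound c1 d1 (n.+1 + s) < n ^ D.
Proof.
move=> D n0 n n0n; have n1 : 1 < n by rewrite /n0 in n0n; lia.
have n_gt0 := ltnW n1.
have le_X : n.+1 + poly_bound c0 d0 n <= n ^ d0.+2.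
  rewrite /poly_bound !expnS; have : 0 < n ^ d0 by rewrite expn_gt0 n_gt0.
  move: (n ^ d0) => Y Y0; have h1 : c0 * Y <= n * Y by rewrite leq_mul2r; lia.
  have h2 : c0 <= n * Y by apply: leq_trans (leq_pmulr _ Y0); lia.
  have h3 : n.+1 <= 2 * (n * Y) by apply: leq_trans (_ : 2 * n <= _); [lia | rewrite leq_mul2l leq_pmulr].
  have h4 : 4 * (n * Y) <= n * (n * Y) by rewrite leq_mul2r; lia.
  lia.
split=> [|s sb].
  by apply: leq_ltn_trans le_X _; rewrite ltn_exp2l // /D; lia.
have le_s : n.+1 + s <= n ^ d0.+2 by apply: leq_trans le_X; rewrite leq_add2l.
have h1 : (n.+1 + s) ^ d1 <= n ^ (d0.+2 * d1).
  by rewrite expnM; case: (d1) => // d; rewrite leq_exp2r.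
apply: (@leq_ltn_trans (2 * c1 * n ^ (d0.+2 * d1))).
  have h2 : 0 < n ^ (d0.+2 * d1) by rewrite expn_gt0 n_gt0.
  rewrite /poly_bound -mulnA mul2n -addnn leq_add ?leq_pmulr //.
  by rewrite leq_mul2l h1 orbT.
apply: (@leq_trans (n ^ (d0.+2 * d1).+1)); last by rewrite leq_exp2l // /D; lia.
by rewrite expnS ltn_pmul2r ?expn_gt0 ?n_gt0 //; rewrite /n0 in n0n; lia.
Qed.

Lemma digits_exist B r (e : nat -> nat) : 0 < B -> (forall c, c < r -> e c < B) ->
  exists2 v, v < B ^ r & forall c, c < r -> digit B c v = e c.
Proof.
move=> B0 eB; exists (of_digits B r e); first exact: of_digits_lt.
by move=> c cr; apply: digit_of_digits.
Qed.

Section Reduction.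
Variable l : nat.
Hypotheses (l_gt1 : 1 < l) (odd_l : odd l).
Variables (M : tm (option bool) bool) (V : seq (option bool) -> bool).
Variables (c0 d0 c1 d1 : nat) (L : language).
Hypothesis computes : forall z, tm_outputs_within M (poly_bound c1 d1 (size z)) z [:: V z].
Hypothesis certified : forall x, L x <-> exists y : seq bool,
  size y <= poly_bound c0 d0 (size x) /\ V (with_certificate x y).

Definition scope_size := 1 + 5 * (4 ^ l * l ^ 2).
Notation K := scope_size.
Notation assignment := {ffun 'I_K -> tcell M}.
Notation code := {ffun assignment -> 'I_l}.

Definition num_digits := (d0.+2 * d1).+1 + d0.+3.
Notation D := num_digits.
(** Beyond it the estimates of [poly_dominated] hold and a single digit can hold a code. *)
Definition threshold := maxn (2 * c0 + 2 * c1 + 10) #|code|.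
Notation n0 := threshold.
Notation r' := (K * 2 * D).
Notation r := r'.+1.
Notation m := (r' + r).+1.

Section Word.
Variable w : seq bool.
Notation n := (size w).
Notation B := n.+1.

(** Equal to [n ^ D] for positive [n]; the successor form makes ['I_P] inhabited. *)
Definition side_length := (n ^ D).-1.+1.
Notation P := side_length.

Definition valid_vertex (v : nat) : bool :=
  [forall c : 'I_r', digit B c v < n] && (digit B r' v < #|{: code}|).

Definition vertex_scope (v : nat) : {ffun 'I_K -> 'I_P * 'I_P} :=
  [ffun i => (inord (vertex_number D w v i false), inord (vertex_number D w v i true))].

Definition code0 : code := [ffun=> Ordinal (ltnW l_gt1)].

Definition vertex_code (v : nat) : code := nth code0 (enum {: code}) (digit B r' v).

Definition vertex_ok := tableau_ok (M := M) w (P := P) (poly_bound c0 d0 n).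

(** For short words the graph has no edges if [L w] holds, and all edges including loops otherwise.
    For long words, numbers that encode no vertex are isolated. *)
Definition vertex_edge (u v : nat) : bool :=
  if n < n0 then ~~ excluded_middle_informative (L w)
  else [&& valid_vertex u, valid_vertex v &
           gadget_edge vertex_ok (vertex_scope u, vertex_code u) (vertex_scope v, vertex_code v)].

Lemma vertex_edge_sym : symmetric vertex_edge.
Proof.
by move=> u v; rewrite /vertex_edge gadget_edge_sym andbCA; case: ifP.
Qed.

Hypothesis big_n : n0 <= n.

Let big_n' : 2 * c0 + 2 * c1 + 10 <= n.
Proof. by apply: leq_trans big_n; apply: leq_maxl. Qed.

Let n_gt0 : 0 < n. Proof. by move: big_n'; lia. Qed.

Let PE : P = n ^ D. Proof. by rewrite /side_length prednK // expn_gt0 n_gt0. Qed.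

Lemma vertex_scope_number u v : valid_vertex u -> valid_vertex v ->
  scope_number (vertex_scope u) (vertex_scope v) =1
  (fun X : bool * 'I_K * bool => vertex_number D w (if X.1.1 then u else v) X.1.2 X.2).
Proof.
have lt z (i : 'I_K) tp : valid_vertex z -> vertex_number D w z i tp < P.
  case/andP=> /forallP ok _; rewrite PE; apply: (of_digits_lt n_gt0) => j jD.
  exact: (ok (Ordinal (number_index_lt tp (ltn_ord i) jD))).
move=> uok vok [[s i] tp]; rewrite /scope_number /=.
by case: s; rewrite ffunE /=; case: (tp); rewrite /= inordK // lt.
Qed.

Lemma vertex_surj (a : {ffun 'I_K -> 'I_P * 'I_P} * code) :
  exists2 v, v < B ^ r & [/\ valid_vertex v, vertex_scope v = a.1 & vertex_code v = a.2].
Proof.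
case: a => U x /=.
(* The digits of the wanted number, obtained by inverting [number_index]. *)
pose e c := if c == r' then index x (enum {: code}) else
  let p := c %/ D in
  let cell := U (inord (p %/ 2)) in
  digit n (c %% D) (if odd p then cell.2 else cell.1).
have D0 : 0 < D by [].
have xi : index x (enum {: code}) < #|{: code}| by rewrite cardE index_mem mem_enum.
have code_n : #|{: code}| <= n by apply: leq_trans big_n; apply: leq_maxr.
have e_lt c : e c < n.
  rewrite /e; case: eqP => _; first exact: leq_trans xi code_n.
  exact: digit_lt.
have [v vB ve] := @digits_exist B r e isT (fun c _ => ltnW (e_lt c)).
have eE (i : 'I_K) (tp : bool) j : j < D ->
    e (number_index D i tp j) = digit n j (if tp then (U i).2 else (U i).1).
  move=> jD; have lt := number_index_lt tp (ltn_ord i) jD.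
  rewrite /e ltn_eqF // /number_index divnMDl // divn_small // addn0 modnMDl modn_small //.
  have -> : (i * 2 + tp) %/ 2 = i by rewrite divnMDl // divn_small ?addn0 //; case: (tp).
  by rewrite inord_val oddD muln2 odd_double oddb.
exists v => //; split.
- apply/andP; split; last by rewrite ve // /e eqxx.
  by apply/forallP=> c; have cr : c < r := ltnW (ltn_ord c); rewrite ve.
- apply/ffunP=> i; rewrite ffunE [RHS]surjective_pairing.
  have numE tp : vertex_number D w v i tp = if tp then (U i).2 else (U i).1.
    rewrite /vertex_number (@eq_of_digits n D _ (digit n ^~ (if tp then (U i).2 else (U i).1))).
      by rewrite of_digitsK // -PE; case: (tp).
    by move=> j jD; rewrite ve ?eE // ltnS ltnW // number_index_lt ?ltn_ord.
  by rewrite !numE !inord_val.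
by rewrite /vertex_code ve // /e eqxx nth_index ?mem_enum.
Qed.

End Word.

Lemma input_at_isSome (w : seq bool) x : isSome (input_at w x) = (x < size w).
Proof.
have [xn|nx] := ltnP; last by rewrite input_at_none.
by have [b ->] := input_at_some xn.
Qed.

Lemma short_word_eq (w1 w2 : seq bool) E :
  (forall x, x < E -> input_at w1 x = input_at w2 x) -> size w1 < E -> w1 = w2.
Proof.
move=> same lt1.
have le21 : size w2 <= size w1 by rewrite leqNgt -input_at_isSome -same // input_at_none.
have le12 : size w1 <= size w2.
  by rewrite leqNgt -input_at_isSome same ?input_at_isSome ?ltnn // (leq_ltn_trans le21).
have eq_size : size w1 = size w2 by apply/eqP; rewrite eqn_leq le12.
apply: (@eq_from_nth _ false) => // x x1; have := same x (ltn_trans x1 lt1).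
by rewrite /input_at !(nth_map false) ?(leq_trans x1) // => -[].
Qed.

(** A short word is determined by its prefix atoms. For long words validity, codes and, by
    [slot_flagsE], flags can be read from the atoms, and [same_gadget_edge] compares the edges. *)
Lemma vertex_edge_atoms w1 u1 v1 w2 u2 v2 :
  u1 < (size w1).+1 ^ r -> v1 < (size w1).+1 ^ r ->
  u2 < (size w2).+1 ^ r -> v2 < (size w2).+1 ^ r ->
  atoms_of m n0 w1 (v1 + u1 * (size w1).+1 ^ r) =
  atoms_of m n0 w2 (v2 + u2 * (size w2).+1 ^ r) ->
  vertex_edge w1 u1 v1 = vertex_edge w2 u2 v2.
Proof.
move=> u1B v1B u2B v2B same.
have same_prefix x : x < n0 -> input_at w1 x = input_at w2 x.
  move=> xn; have := congr1 (fun a => at_prefix a (Ordinal xn)) same.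
  by rewrite !ffunE.
pose dg (w : seq bool) u v (s : bool) c := digit (size w).+1 c (if s then u else v).
pose ix (s : bool) c : 'I_m := inord ((if s then r else 0) + c).
have ixE (w : seq bool) u v s c : v < (size w).+1 ^ r -> c < r ->
    digit (size w).+1 (ix s c) (v + u * (size w).+1 ^ r) = dg w u v s c.
  move=> vB cr; rewrite /ix inordK; last by case: s; lia.
  by case: s; rewrite /dg /= ?digit_pair_high // add0n digit_pair.
have same_in s c : c < r -> input_at w1 (dg w1 u1 v1 s c) = input_at w2 (dg w2 u2 v2 s c).
  move=> cr; have := congr1 (fun a => at_input a (ix s c)) same.
  by rewrite !ffunE !ixE.
have same_const s c e : c < r -> e < n0 -> (dg w1 u1 v1 s c == e) = (dg w2 u2 v2 s c == e).
  move=> cr en; have := congr1 (fun a => at_const a (ix s c, Ordinal en)) same.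
  by rewrite !ffunE /= !ixE.
have [small1|big1] := ltnP (size w1) n0.
  have E := short_word_eq same_prefix small1; rewrite -E in u2B v2B same *.
  by rewrite /vertex_edge small1.
have [small2|big2] := ltnP (size w2) n0.
  have E : w2 = w1 by apply: short_word_eq small2 => x xn; rewrite same_prefix.
  by move: small2; rewrite E ltnNge big1.
have same_valid_at (s : bool) : valid_vertex w1 (if s then u1 else v1) =
    valid_vertex w2 (if s then u2 else v2).
  congr andb.
    apply: eq_forallb => c; have cr : c < r := ltnW (ltn_ord c).
    by have := congr1 isSome (same_in s c cr); rewrite !input_at_isSome.
  have le_n0 : #|{: code}| <= n0 by apply: leq_maxr.
  apply/idP/idP => lt.
    have := same_const s r' _ (ltnSn _) (leq_trans lt le_n0).
    by rewrite /dg eqxx => /esym/eqP ->.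
  have := same_const s r' _ (ltnSn _) (leq_trans lt le_n0).
  by rewrite /dg eqxx => /eqP ->.
have same_code (s : bool) : valid_vertex w1 (if s then u1 else v1) ->
    vertex_code w1 (if s then u1 else v1) = vertex_code w2 (if s then u2 else v2).
  case/andP=> _ lt; have le_n0 : #|{: code}| <= n0 by apply: leq_maxr.
  have := same_const s r' _ (ltnSn _) (leq_trans lt le_n0).
  by rewrite /vertex_code /dg eqxx => /esym/eqP ->.
rewrite /vertex_edge !ltnNge big1 big2 /= -(same_valid_at true) -(same_valid_at false) /=.
case uok : (valid_vertex w1 u1) => //; case vok : (valid_vertex w1 v1) => //=.
have uok2 : valid_vertex w2 u2 by have := same_valid_at true; rewrite /= uok.
have vok2 : valid_vertex w2 v2 by have := same_valid_at false; rewrite /= vok.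
rewrite -(same_code true uok) -(same_code false vok) /=.
apply: same_gadget_edge.
have flagsE w u v : n0 <= size w -> u < (size w).+1 ^ r -> v < (size w).+1 ^ r ->
    valid_vertex w u -> valid_vertex w v ->
    flags w (side_length w) ((size w).+1 + poly_bound c0 d0 (size w))
      (scope_number (vertex_scope w u) (vertex_scope w v)) =
    slot_flags c0 d0 (atoms_of m n0 w (v + u * (size w).+1 ^ r)).
  move=> big uB vB uv vv; rewrite (eq_flags _ _ _ (vertex_scope_number big uv vv)).
  have big' : 2 * c0 + 2 * c1 + 10 <= n0 by apply: leq_maxl.
  have n_gt0 : 0 < size w by apply: leq_trans big; lia.
  rewrite [side_length w](_ : _ = size w ^ D); last first.
    by rewrite /side_length prednK // expn_gt0 n_gt0.
  apply: slot_flagsE => //.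
  - by rewrite /num_digits; lia.
  - by rewrite /num_digits; lia.
  - by apply: leq_trans big; lia.
  - by lia.
  - by move=> c cr; case/andP: uv => /forallP/(_ (Ordinal cr)).
  - by move=> c cr; case/andP: vv => /forallP/(_ (Ordinal cr)).
by rewrite !flagsE // same.
Qed.

(* Words shorter than [threshold] are determined by their atoms, so the truth value
   of [L] on them can be stored in the rule. *)
Definition edge_rule (a : atoms m n0) : bool :=
  excluded_middle_informative (exists w u v, [/\ u < (size w).+1 ^ r, v < (size w).+1 ^ r,
    atoms_of m n0 w (v + u * (size w).+1 ^ r) = a & vertex_edge w u v]).

Lemma edge_ruleE w u v : u < (size w).+1 ^ r -> v < (size w).+1 ^ r ->
  edge_rule (atoms_of m n0 w (v + u * (size w).+1 ^ r)) = vertex_edge w u v.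
Proof.
move=> uB vB; rewrite /edge_rule; case: excluded_middle_informative => /= [|none]; last first.
  by apply/esym/negP => e; apply: none; exists w, u, v.
case=> [w' [u' [v' [u'B v'B E e]]]].
by rewrite -(vertex_edge_atoms u'B v'B uB vB E).
Qed.

Definition word_graph (w : seq bool) : graph :=
  @Graph 'I_((size w).+1 ^ r) (fun u v => vertex_edge w u v)
    (fun u v => vertex_edge_sym w u v).

Lemma encode_word_graph w : matrix_word r edge_rule w = encode_graph (word_graph w).
Proof.
set B := (size w).+1; have Br : 0 < B ^ r by rewrite expn_gt0.
rewrite /word_graph encode_ord_graph /matrix_word; congr (_ ++ _ :: _).
have -> : (size w).+1 ^ m = B ^ r * B ^ r by rewrite -expnD.
apply/eq_in_map => N; rewrite mem_iota add0n => /= NB.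
rewrite -edge_ruleE; last by rewrite ltn_mod.
  have -> : N %% B ^ r + N %/ B ^ r * B ^ r = N by rewrite addnC -divn_eq.
  by [].
by rewrite ltn_divLR.
Qed.

Lemma large_word_bounds w : n0 <= size w ->
  (size w).+1 + poly_bound c0 d0 (size w) < side_length w /\
  forall y : seq bool, size y <= poly_bound c0 d0 (size w) ->
    poly_bound c1 d1 ((size w).+1 + size y) < side_length w.
Proof.
move=> big; have big' : 2 * c0 + 2 * c1 + 10 <= size w.
  by apply: leq_trans big; apply: leq_maxl.
have [h1 h2] := poly_dominated d0 d1 big'.
have -> : side_length w = size w ^ D.
  by rewrite /side_length prednK // expn_gt0; apply/orP; left; lia.
by split=> // y; apply: h2.
Qed.

Lemma reduction_yes w : L w -> has_hom (word_graph w) (cycle_graph l).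
Proof.
move=> Lw; have [small|big] := ltnP (size w) n0.
  exists (fun=> Ordinal (ltnW l_gt1)) => u v; rewrite /= /vertex_edge small.
  by case: excluded_middle_informative.
have [y [yb Vy]] := proj1 (certified w) Lw.
have [h1 h2] := large_word_bounds big.
have [sigma sol] := tableau_complete (isT : 0 < side_length w) computes h2 yb Vy.
have [phi phiP] := gadget_complete l K sol.
exists (fun v : 'I_((size w).+1 ^ r) => phi (vertex_scope w v, vertex_code w v)) => u v.
by rewrite /= /vertex_edge ltnNge big /= => /and3P[_ _ /phiP].
Qed.

Lemma reduction_no w : ~ L w -> ~ has_hom (word_graph w) (complete_graph 4).
Proof.
move=> nLw [chi chiP]; have [small|big] := ltnP (size w) n0.
  have B0 : 0 < (size w).+1 ^ r by rewrite expn_gt0.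
  have := chiP (Ordinal B0) (Ordinal B0); rewrite /= /vertex_edge small.
  by case: excluded_middle_informative => //= _ /(_ isT); rewrite /complete_rel eqxx.
have vertexP a : exists v : 'I_((size w).+1 ^ r),
    [/\ valid_vertex w v, vertex_scope w v = a.1 & vertex_code w v = a.2].
  by have [v vB h] := vertex_surj big a; exists (Ordinal vB).
(* Choosing a number for every gadget vertex pulls the 4-colouring back to the gadget graph. *)
pose vertex_of a := proj1_sig (constructive_indefinite_description _ (vertexP a)).
have vertex_ofP a := proj2_sig (constructive_indefinite_description _ (vertexP a)).
have [h1 h2] := large_word_bounds big.
have [|sigma sol] := @gadget_sound l _ _ 5 K (vertex_ok (w := w)) l_gt1 odd_l isT (leqnn _)
  (fun a => chi (vertex_of a)) _ (ord0, ord0).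
  move=> a b ab; apply: chiP; rewrite /= /vertex_edge ltnNge big /=.
  have [va sa ca] := vertex_ofP a; have [vb sb cb] := vertex_ofP b.
  by rewrite /vertex_of va vb sa ca sb cb -!surjective_pairing.
have [y yb Vy] := tableau_sound (isT : 0 < side_length w) computes h1 h2 sol.
by apply: nLw; apply/certified; exists y.
Qed.

Lemma reduction : karp_reduces L (PCSP (cycle_graph l) (complete_graph 4)).
Proof.
exists (matrix_word r edge_rule); split.
  apply: matrix_word_polytime; first by rewrite -addSn leq_addl.
  by apply: (@leq_trans (2 * c0 + 2 * c1 + 10)); [lia | apply: leq_maxl].
move=> w; split=> [Lw|nLw]; exists (word_graph w); split; rewrite ?encode_word_graph //.
  exact: reduction_yes.
exact: reduction_no.
Qed.

End Reduction.
Theorem theorem3p1 (l : nat) (hl : 3 <= l) (hodd : odd l) :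
  NP_hard (PCSP (cycle_graph l) (complete_graph 4)).
Proof.
move=> L [V [c [d [[M [c1 [d1 computes]]] certified]]]].
exact: (@reduction l (ltnW hl) hodd M V c d c1 d1 L computes certified).
Qed.
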